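(* Let $\mathcal{X}=\mathbb{R}$ with $c(x,y)=|x-y|$, let $V_1\subseteq\mathbb{R}$ be finite with $|V_1|$ even, and let $G_1$ be the complete graph on $V_1$. Then there is a perfect matching $M_1$ in $G_1$ that is two-stage $(10,2)$-robust (where the number $2k$ of arriving nodes is not known when $M_1$ is chosen). Such a matching, as well as a second stage reply for any given set of $2k$ arriving nodes, can be computed in time polynomial in $|V_1|$ and $k$.
   Context: Two-stage model: In the first stage one is given the complete graph $G_1$ on a finite even set $V_1\subseteq\mathbb{R}$, with the cost of edge $\{v,w\}$ equal to $|v-w|$, and must choose a perfect matching $M_1$ of $G_1$. In the second stage, $2k$ additional nodes (points of $\mathbb{R}$) arrive for some $k\in\mathbb{N}$, giving the complete graph $G_2$ on $V_1$ together with these nodes (same cost function), and one must choose a perfect matching $M_2$ of $G_2$ (a ''second stage reply''). For $i\in\{1,2\}$ let $O_i$ be a min-cost perfect matching of $G_i$; $c(F)=\sum_{e\in F}c(e)$. A perfect matching $M_1$ of $G_1$ is two-stage $(\alpha,\beta)$-robust if $c(M_1)\le\alpha\,c(O_1)$ and, for every $k\in\mathbb{N}$ and every set of $2k$ arriving nodes, there exists a perfect matching $M_2$ of the resulting $G_2$ with $c(M_2)\le\alpha\,c(O_2)$ and $|M_1\setminus M_2|\le\beta k$. *)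

(* Defs.v *)
From mathcomp Require Import all_boot all_order all_algebra.
From mathcomp Require Import finmap reals.

Set Implicit Arguments.
Unset Strict Implicit.
Unset Printing Implicit Defensive.

Import Order.TTheory GRing.Theory Num.Theory.
Local Open Scope fset_scope.
Local Open Scope ring_scope.

(* Perfect matchings of the complete graph on a finite set of reals; an edge *)
(* {v, w} is the two-element set [fset v; w].                                *)

Definition perfect_matching (R : realType) (V : {fset R})
    (M : {fset {fset R}}) : Prop :=
  (forall e, e \in M -> e `<=` V /\ #|` e| = 2%N) /\
  (forall v, v \in V -> exists! e, e \in M /\ v \in e).

(* The double sum runs over ordered pairs, so it counts |v - w| twice when   *)
(* e = {v, w}; see edge_cost2.                                               *)
Definition edge_cost (R : realType) (e : {fset R}) : R :=
  (\sum_(v <- e) \sum_(w <- e) `|v - w|) / 2.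

Lemma edge_cost2 (R : realType) (v w : R) : edge_cost [fset v; w] = `|v - w|.
Proof.
rewrite /edge_cost; case: (eqVneq v w) => [->|vw].
  by rewrite fsetUid !big_seq_fset1 subrr normr0 mul0r.
have E (F : R -> R) : \sum_(x <- [fset v; w]) F x = F v + F w.
  by rewrite big_fsetU1 ?inE //= big_seq_fset1.
rewrite !E !subrr normr0 add0r addr0 (distrC w v) -mulr2n.
by rewrite -[X in X / 2]mulr_natr mulfK // pnatr_eq0.
Qed.

Definition cost (R : realType) (M : {fset {fset R}}) : R :=
  \sum_(e <- M) edge_cost e.

Definition min_cost_perfect_matching (R : realType) (V : {fset R})
    (O : {fset {fset R}}) : Prop :=
  perfect_matching V O /\
  forall M, perfect_matching V M -> cost O <= cost M.

Definition approx_perfect_matching (R : realType) (alpha : R) (V : {fset R})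
    (M : {fset {fset R}}) : Prop :=
  perfect_matching V M /\
  exists O, min_cost_perfect_matching V O /\ cost M <= alpha * cost O.

Definition second_stage_reply (R : realType) (alpha beta : R)
    (V1 : {fset R}) (M1 : {fset {fset R}}) (k : nat) (W : {fset R})
    (M2 : {fset {fset R}}) : Prop :=
  approx_perfect_matching alpha (V1 `|` W) M2 /\
  #|` M1 `\` M2|%:R <= beta * k%:R.

Definition two_stage_robust (R : realType) (alpha beta : R) (V1 : {fset R})
    (M1 : {fset {fset R}}) : Prop :=
  approx_perfect_matching alpha V1 M1 /\
  forall (k : nat) (W : {fset R}), #|` W| = k.*2 -> [disjoint V1 & W] ->
    exists M2, second_stage_reply alpha beta V1 M1 k W M2.

(* Model of computation: structured programs of a real RAM.  The memory      *)
(* consists of arrays of naturals and arrays of exact reals, of which a      *)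
(* program names finitely many; a scalar variable is a cell with a constant  *)
(* index.  Every operation costs 1.  The arithmetic is limited to addition,  *)
(* (truncated, on naturals) subtraction and comparison: unit-cost            *)
(* multiplication, rounding and arbitrary real constants are unavailable, so *)
(* that the operation count does not hide superpolynomial work.              *)

Inductive iexp : Type :=
  | ICst of nat
  | IGet of nat & iexp          (* array name, index *)
  | IAdd of iexp & iexp
  | ISub of iexp & iexp.

Inductive rexp : Type :=
  | RCst of nat
  | RGet of nat & iexp
  | RAdd of rexp & rexp
  | RSub of rexp & rexp.

Inductive bexp : Type :=
  | BILe of iexp & iexp
  | BRLe of rexp & rexp
  | BNot of bexp
  | BAnd of bexp & bexp.

Inductive cmd : Type :=
  | Skip
  | ISet of nat & iexp & iexp   (* array name, index, value *)
  | RSet of nat & iexp & rexp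
  | Seq of cmd & cmd
  | If of bexp & cmd & cmd
  | While of bexp & cmd.

Record state (R : realType) : Type := State {
  imem : nat -> nat -> nat;
  rmem : nat -> nat -> R }.

Fixpoint ieval (R : realType) (st : state R) (e : iexp) : nat :=
  match e with
  | ICst n => n
  | IGet a i => imem st a (ieval st i)
  | IAdd e1 e2 => (ieval st e1 + ieval st e2)%N
  | ISub e1 e2 => (ieval st e1 - ieval st e2)%N
  end.

Fixpoint reval (R : realType) (st : state R) (e : rexp) : R :=
  match e with
  | RCst n => n%:R
  | RGet a i => rmem st a (ieval st i)
  | RAdd e1 e2 => reval st e1 + reval st e2
  | RSub e1 e2 => reval st e1 - reval st e2
  end.

Fixpoint beval (R : realType) (st : state R) (b : bexp) : bool :=
  match b with
  | BILe e1 e2 => (ieval st e1 <= ieval st e2)%N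
  | BRLe e1 e2 => reval st e1 <= reval st e2
  | BNot b1 => ~~ beval st b1
  | BAnd b1 b2 => beval st b1 && beval st b2
  end.

Fixpoint icost (e : iexp) : nat :=
  match e with
  | ICst _ => 1%N
  | IGet _ i => (icost i).+1
  | IAdd e1 e2 | ISub e1 e2 => (icost e1 + icost e2).+1
  end.

Fixpoint rcost (e : rexp) : nat :=
  match e with
  | RCst _ => 1%N
  | RGet _ i => (icost i).+1
  | RAdd e1 e2 | RSub e1 e2 => (rcost e1 + rcost e2).+1
  end.

Fixpoint bcost (b : bexp) : nat :=
  match b with
  | BILe e1 e2 => (icost e1 + icost e2).+1
  | BRLe e1 e2 => (rcost e1 + rcost e2).+1
  | BNot b1 => (bcost b1).+1
  | BAnd b1 b2 => (bcost b1 + bcost b2).+1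
  end.

Definition upd (T : Type) (f : nat -> nat -> T) (a i : nat) (x : T) :
    nat -> nat -> T :=
  fun b j => if (b == a) && (j == i) then x else f b j.

(* exec c st n st' : started in st, the program c halts in state st' after n *)
(* steps.                                                                    *)
Inductive exec (R : realType) : cmd -> state R -> nat -> state R -> Prop :=
  | exec_skip st : exec Skip st 1 st
  | exec_iset st a i e :
      exec (ISet a i e) st (icost i + icost e).+1
        (State (upd (imem st) a (ieval st i) (ieval st e)) (rmem st))
  | exec_rset st a i e :
      exec (RSet a i e) st (icost i + rcost e).+1
        (State (imem st) (upd (rmem st) a (ieval st i) (reval st e)))
  | exec_seq c1 c2 st n1 st1 n2 st2 :
      exec c1 st n1 st1 -> exec c2 st1 n2 st2 ->
      exec (Seq c1 c2) st (n1 + n2) st2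
  | exec_if b c1 c2 st n st' :
      exec (if beval st b then c1 else c2) st n st' ->
      exec (If b c1 c2) st (bcost b + n).+1 st'
  | exec_while_false b c st :
      ~~ beval st b -> exec (While b c) st (bcost b).+1 st
  | exec_while_true b c st n1 st1 n2 st2 :
      beval st b -> exec c st n1 st1 -> exec (While b c) st1 n2 st2 ->
      exec (While b c) st (bcost b + n1 + n2).+1 st2.

(* The given arrays are loaded under the names 0, 1, ...; every other cell   *)
(* holds 0.                                                                  *)
Definition init (R : realType) (ints : seq (seq nat)) (reals : seq (seq R)) :
    state R :=
  State (fun a i => nth 0%N (nth [::] ints a) i)
        (fun a i => nth 0 (nth [::] reals a) i).

(* On termination the output m is in the integer array 2.                    *)
Definition computes_within (R : realType) (time : nat) (c : cmd)
    (st : state R) (m : seq nat) : Prop :=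
  exists n st', [/\ exec c st n st', (n <= time)%N &
                    m = mkseq (imem st' 2) (size m)].

(* A matching on the points listed by s is given to, and returned by, a      *)
(* program as the list m of partners: point number i is matched with point   *)
(* number m_i.                                                               *)
Definition encodes (R : realType) (s : seq R) (m : seq nat)
    (M : {fset {fset R}}) : Prop :=
  [/\ size m = size s, all (fun j => j < size s)%N m &
      M = [fset [fset s`_i; s`_(nth 0%N m i)] | i in iota 0 (size s)]].

Definition stage1_input (R : realType) (s : seq R) : state R :=
  init [:: [:: size s]] [:: s].

Definition stage2_input (R : realType) (s : seq R) (m1 : seq nat) (k : nat)
    (t : seq R) : state R :=
  init [:: [:: size s; k]; m1] [:: s ++ t].

(* Main.v *)
Require Import Defs.
From mathcomp Require Import all_boot all_order all_algebra.
From mathcomp Require Import finmap reals.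
From mathcomp Require Import zify ring lra.

(* On the line the cheapest matching with j edges is found greedily: among    *)
(* the uncovered points, repeatedly cover the two neighbours joined by the    *)
(* cheapest augmenting path.  Let c j be the cost after j steps, and 2n the   *)
(* number of points of V1.  Since O_2 restricted to V1 contains at least      *)
(* n - k disjoint edges, c (n - k) <= c(O_2).                                 *)
(*   Going from j = n down to 0, open a new level whenever c j has dropped to *)
(* half of its value at the start of the current level, and let M_1 match the *)
(* points covered within each level among themselves, in sorted order.  The   *)
(* points of a level are those covered by one greedy matching and not by      *)
(* another, so by the triangle inequality a level costs at most the sum of    *)
(* the two costs, and the costs at the successive starts form a geometric     *)
(* series.                                                                    *)
(*   When 2k points arrive, let t >= n - k be the start of the level of step  *)
(* n - k.  Keep the levels of the steps up to t, of total cost at most        *)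
(* 3 c t, and match in sorted order all other points, of which at most 2k lie *)
(* in V1; that costs at most c(O_2) + c t.  As c t <= 2 c (n - k), the total  *)
(* is at most 9 c(O_2).  With k = 0 the same construction yields M_1, so one  *)
(* program serves both stages, and the second ignores the encoding of M_1.    *)

(** For a sorted list of even size, [alt] is the cost of pairing it in order, and equals the total
    length of the gaps with an odd number of points to their left. Hence it is subadditive under
    symmetric difference ([alt_addb]); this one inequality yields the lower bound [alt_le_cost] on
    every perfect matching and replaces all triangle inequalities of the argument. Matchings are
    given by labellings, each label class being paired in sorted order ([label_matchingP]).

    Optimality of the greedy partial matchings is an exchange argument on lists: deleting the
    cheapest pair of neighbours reduces the choice of j + 1 pairs to that of j
    ([selection_contract], [gcost_opt]). With [selection_alt] it bounds the greedy cost at step n -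
    k by the optimum after the arrivals. [level_cut] carries out the halving scheme, [solution_spec]
    adds up the costs and [solution_reply] counts the lost edges.

    For the running time, the algorithm is written in a language whose loops all obey one fixed
    bound. [time_poly] then holds for every program, and what remains for this one is its
    correctness, [main_progP]. *)

Set Implicit Arguments.
Unset Strict Implicit.
Unset Printing Implicit Defensive.

Import Order.TTheory GRing.Theory Num.Theory.
Local Open Scope fset_scope.
Local Open Scope ring_scope.

(** * Programs with bounded loops *)

(* Every loop runs [imem st bnd 0] times and no loop body may write that     *)
(* cell: this is what makes the running time polynomial whatever the program *)
(* computes.                                                                 *)
Inductive prog : Type :=
  | PSkip
  | PISet of nat & iexp & iexp
  | PRSet of nat & iexp & rexp
  | PSeq of prog & prog
  | PIf of bexp & prog & prog
  | PFor of nat & prog.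

Definition bnd : nat := 5.

Definition ivar (x : nat) : iexp := IGet x (ICst 0).

Fixpoint compile (c : prog) : cmd :=
  match c with
  | PSkip => Skip
  | PISet a i e => ISet a i e
  | PRSet a i e => RSet a i e
  | PSeq c1 c2 => Seq (compile c1) (compile c2)
  | PIf b c1 c2 => If b (compile c1) (compile c2)
  | PFor x c1 =>
      Seq (ISet x (ICst 0) (ICst 0))
        (While (BNot (BILe (ivar bnd) (ivar x)))
           (Seq (compile c1) (ISet x (ICst 0) (IAdd (ivar x) (ICst 1)))))
  end.

Fixpoint iwrites (c : prog) : seq nat :=
  match c with
  | PSkip | PRSet _ _ _ => [::]
  | PISet a _ _ => [:: a]
  | PSeq c1 c2 | PIf _ c1 c2 => iwrites c1 ++ iwrites c2
  | PFor x c1 => x :: iwrites c1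
  end.

Fixpoint rwrites (c : prog) : seq nat :=
  match c with
  | PSkip | PISet _ _ _ => [::]
  | PRSet a _ _ => [:: a]
  | PSeq c1 c2 | PIf _ c1 c2 => rwrites c1 ++ rwrites c2
  | PFor _ c1 => rwrites c1
  end.

Fixpoint wf (c : prog) : bool :=
  match c with
  | PSkip => true
  | PISet a _ _ => a != bnd
  | PRSet _ _ _ => true
  | PSeq c1 c2 | PIf _ c1 c2 => wf c1 && wf c2
  | PFor x c1 => [&& x != bnd, x \notin iwrites c1 & wf c1]
  end.

(** Both branches of a conditional are charged, so that the bound depends on [N] alone. An iteration
    pays 6 for the test, 6 for the increment and 1 for the loop; the 10 pays for the initialisation
    (3) and the last, failing test (7). *)
Fixpoint time (c : prog) (N : nat) : nat :=
  match c with
  | PSkip => 1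
  | PISet _ i e => (icost i + icost e).+1
  | PRSet _ i e => (icost i + rcost e).+1
  | PSeq c1 c2 => time c1 N + time c2 N
  | PIf b c1 c2 => (bcost b + (time c1 N + time c2 N)).+1
  | PFor _ c1 => N * (time c1 N + 13) + 10
  end%N.

(** Each loop raises the degree by one; the other constructs keep the larger degree and add
    constants. *)
Lemma time_poly (c : prog) :
  exists C d, forall N, (time c N <= C * N.+1 ^ d)%N.
Proof.
have weaken C d d' N : (d <= d' -> C * N.+1 ^ d <= C * N.+1 ^ d')%N.
  by move=> le; rewrite leq_mul // leq_pexp2l.
have cst b : exists C d, forall N, (b <= C * N.+1 ^ d)%N.
  by exists b, 0%N => N; rewrite expn0 muln1.
elim: c => [|a i e|a i e|c1 [C1 [d1 H1]] c2 [C2 [d2 H2]]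
  |b c1 [C1 [d1 H1]] c2 [C2 [d2 H2]]|x c [C [d H]]] /=; try exact: cst.
- exists (C1 + C2)%N, (maxn d1 d2) => N; rewrite mulnDl.
  apply: leq_add; [apply: leq_trans (H1 N) _|apply: leq_trans (H2 N) _].
    exact: weaken (leq_maxl _ _).
  exact: weaken (leq_maxr _ _).
- exists ((bcost b).+1 + (C1 + C2))%N, (maxn d1 d2) => N; rewrite -addSn !mulnDl.
  apply: leq_add; first by rewrite leq_pmulr // expn_gt0.
  apply: leq_add; [apply: leq_trans (H1 N) _|apply: leq_trans (H2 N) _].
    exact: weaken (leq_maxl _ _).
  exact: weaken (leq_maxr _ _).
- exists (C + 23)%N, d.+1 => N; rewrite expnS.
  have := H N; have : (0 < N.+1 ^ d)%N by rewrite expn_gt0.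
  set X := (N.+1 ^ d)%N; nia.
Qed.

(** * Denotational semantics, frame properties and a loop rule *)

Section Semantics.
Variable R : realType.
Implicit Types (st s : state R) (c : prog).

Definition iset st a i v : state R := State (upd (imem st) a i v) (rmem st).
Definition rset st a i v : state R := State (imem st) (upd (rmem st) a i v).

Fixpoint den c st : state R :=
  match c with
  | PSkip => st
  | PISet a i e => iset st a (ieval st i) (ieval st e)
  | PRSet a i e => rset st a (ieval st i) (reval st e)
  | PSeq c1 c2 => den c2 (den c1 st)
  | PIf b c1 c2 => if beval st b then den c1 st else den c2 st
  | PFor x c1 =>
      iter (imem st bnd 0)
        (fun s => let s' := den c1 s in iset s' x 0 (imem s' x 0 + 1)%N)
        (iset st x 0 0)
  end.

Lemma den_iframe c st a i : a \notin iwrites c -> imem (den c st) a i = imem st a i.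
Proof.
elim: c st => [|b j e|b j e|c1 IH1 c2 IH2|b c1 IH1 c2 IH2|x c IH] st //=.
- by rewrite inE /upd => /negbTE ->.
- by rewrite mem_cat negb_or => /andP[h1 h2]; rewrite IH2 // IH1.
- by rewrite mem_cat negb_or => /andP[h1 h2]; case: ifP; rewrite (IH1, IH2).
- rewrite inE negb_or => /andP[/negbTE ax ac].
  elim: (imem st bnd 0) => [|n IHn] /=; first by rewrite /upd ax.
  by rewrite /upd ax /= IH.
Qed.

Lemma den_rframe c st a i : a \notin rwrites c -> rmem (den c st) a i = rmem st a i.
Proof.
elim: c st => [|b j e|b j e|c1 IH1 c2 IH2|b c1 IH1 c2 IH2|x c IH] st //=.
- by rewrite inE /upd => /negbTE ->.
- by rewrite mem_cat negb_or => /andP[h1 h2]; rewrite IH2 // IH1.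
- by rewrite mem_cat negb_or => /andP[h1 h2]; case: ifP; rewrite (IH1, IH2).
- by move=> ac; elim: (imem st bnd 0) => [|n IHn] //=; rewrite IH.
Qed.

Lemma wf_bnd c : wf c -> bnd \notin iwrites c.
Proof.
elim: c => [|b j e|b j e|c1 IH1 c2 IH2|b c1 IH1 c2 IH2|x c IH] //=.
- by rewrite inE eq_sym.
- by case/andP=> /IH1 h1 /IH2 h2; rewrite mem_cat negb_or h1.
- by case/andP=> /IH1 h1 /IH2 h2; rewrite mem_cat negb_or h1.
- by case/and3P=> h1 _ /IH h2; rewrite inE negb_or eq_sym h1.
Qed.

Lemma compile_exec c st : wf c ->
  exists2 n, exec (compile c) st n (den c st) & (n <= time c (imem st bnd 0))%N.
Proof.
elim: c st => [|b j e|b j e|c1 IH1 c2 IH2|b c1 IH1 c2 IH2|x c IH] st /=.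
- by move=> _; exists 1%N => //; constructor.
- by move=> _; eexists; [exact: exec_iset|].
- by move=> _; eexists; [exact: exec_rset|].
- case/andP=> w1 w2.
  have [n1 e1 l1] := IH1 st w1; have [n2 e2 l2] := IH2 (den c1 st) w2.
  exists (n1 + n2)%N; first exact: exec_seq e1 e2.
  by rewrite leq_add // (leq_trans l2) // den_iframe ?wf_bnd.
- case/andP=> w1 w2.
  have [n1 e1 l1] := IH1 st w1; have [n2 e2 l2] := IH2 st w2.
  exists (bcost b + if beval st b then n1 else n2).+1%N.
    by apply: exec_if; case: ifP.
  by rewrite ltnS leq_add2l; case: ifP => _; lia.
- case/and3P=> xb xc wc.
  set b := BNot _; set body := Seq (compile c) _; set f := fun s : state R => _.
  set T := time c (imem st bnd 0).
  (* Here [r] is the number of iterations left. *)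
  have loop r s : imem s bnd 0 = imem st bnd 0 ->
      (imem s x 0 + r = imem st bnd 0)%N ->
      exists2 n, exec (While b body) s n (iter r f s) & (n <= r * (T + 13) + 7)%N.
    elim: r s => [|r IHr] s sb sx.
      exists (bcost b).+1 => //; apply: exec_while_false.
      by rewrite /= sb -sx addn0 leqnn.
    have [n1 e1 l1] := IH s wc.
    have [|/=|n2 e2 l2] := IHr (f s).
    + by rewrite /f /= /upd [_ == x]eq_sym (negbTE xb) /= den_iframe ?wf_bnd.
    + by rewrite /f /= /upd !eqxx /= den_iframe // -sx; lia.
    exists (bcost b + (n1 + 6) + n2).+1%N.
      rewrite iterSr; apply: exec_while_true e2.
        by rewrite /= sb -sx; lia.
      exact: (exec_seq e1 (exec_iset _ _ _ _)).
    rewrite sb in l1; rewrite /= -/T in l1 *.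
    by rewrite mulSn; lia.
  have [|/=|n e l] := loop (imem st bnd 0) (iset st x 0 0).
  + by rewrite /= /upd eq_sym (negbTE xb).
  + by rewrite /upd !eqxx.
  exists (3 + n)%N; last by rewrite -/T; lia.
  by apply: exec_seq e; exact: exec_iset.
Qed.

(** The frame conditions are supplied by the rule, so that an invariant need only speak of the cells
    that the body writes. *)
Lemma for_rule x c st (P : nat -> state R -> Prop) :
  wf (PFor x c) ->
  P 0%N (iset st x 0 0) ->
  (forall i s, (i < imem st bnd 0)%N -> imem s x 0 = i ->
     (forall a j, a \notin x :: iwrites c -> imem s a j = imem st a j) ->
     (forall a j, a \notin rwrites c -> rmem s a j = rmem st a j) ->
     P i s -> P i.+1 (iset (den c s) x 0 i.+1)) ->
  P (imem st bnd 0) (den (PFor x c) st).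
Proof.
rewrite /= => /and3P[xb xc wc] P0 PS; set f := fun s : state R => _.
suff : forall n, (n <= imem st bnd 0)%N ->
    [/\ imem (iter n f (iset st x 0 0)) x 0 = n,
        (forall a j, a \notin x :: iwrites c ->
           imem (iter n f (iset st x 0 0)) a j = imem st a j),
        (forall a j, a \notin rwrites c ->
           rmem (iter n f (iset st x 0 0)) a j = rmem st a j) &
        P n (iter n f (iset st x 0 0))].
  by move=> /(_ _ (leqnn _)) [].
elim=> [|n IHn] lt.
  split=> //=; first by rewrite /upd !eqxx.
  by move=> a j; rewrite inE negb_or /upd => /andP[/negbTE ->].
have [Ex Ei Er Pn] := IHn (ltnW lt).
have -> : iter n.+1 f (iset st x 0 0) =
    iset (den c (iter n f (iset st x 0 0))) x 0 n.+1.
  by rewrite [LHS]/= {1}/f /= den_iframe // Ex addn1.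
split=> /=.
- by rewrite /= /upd !eqxx.
- move=> a j ain; have := ain; rewrite inE negb_or => /andP[/negbTE ax ac].
  by rewrite /= /upd ax /= den_iframe // Ei.
- by move=> a j ac; rewrite /= den_rframe // Er.
- exact: PS.
Qed.

End Semantics.

(** * Matchings of sorted sequences *)

Lemma seq_ind2 (T : Type) (P : seq T -> Prop) :
  P [::] -> (forall a, P [:: a]) -> (forall a b s, P s -> P (a :: b :: s)) ->
  forall s, P s.
Proof.
move=> P0 P1 P2 s; elim: {s}(size s).+1 {-2}s (ltnSn (size s)) => // n IH.
by case=> [|a [|b s]] //= lt; apply/P2/IH; rewrite ltnW.
Qed.

(** * The optimal cost on the line as an alternating sum *)

Section AlternatingSum.
Variable R : realType.
Implicit Types (s : seq R) (P Q : pred R).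

(* For s sorted of even size: the cost of an optimal perfect matching of s.  *)
Fixpoint alt s : R :=
  if s is a :: s1 then if s1 is b :: s2 then (b - a) + alt s2 else 0 else 0.

(* The total length of the gaps of x :: s that lie to the right of an odd    *)
(* number of points of P, the parity at x being b.  Subadditivity is evident *)
(* for this form of [alt (filter P s)].                                      *)
Fixpoint gap_parity (b : bool) x P s : R :=
  if s is y :: s1 then
    (if b then y - x else 0) + gap_parity (b (+) P y) y P s1
  else 0.

(** A pair of [alt] is open exactly while the parity is odd; the evenness condition says that the
    last pair gets closed. *)
Lemma gap_parityE b x P s : ~~ (b (+) odd (count P s)) ->
  gap_parity b x P s = alt ((if b then [:: x] else [::]) ++ filter P s).
Proof.
elim: s b x => [|y s IH] b x /=; first by case: b.
rewrite oddD; case: b; case Py: (P y) => /=; rewrite ?addTb ?addFb ?negbK => ev.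
- by rewrite IH.
- rewrite IH /=; last by case: odd ev.
  have : (0 < size (filter P s))%N by rewrite size_filter; case: count ev.
  by case: (filter P s) => // z r _ /=; ring.
- by rewrite add0r IH /=; move: ev; case: odd.
- by rewrite add0r IH.
Qed.

(** Gap by gap: the parity of the symmetric difference is odd only if one of the two parities is,
    and gaps of a sorted list are nonnegative. *)
Lemma gap_parity_addb b1 b2 x P Q s : path <=%R x s ->
  gap_parity (b1 (+) b2) x (fun v => P v (+) Q v) s <=
  gap_parity b1 x P s + gap_parity b2 x Q s.
Proof.
elim: s b1 b2 x => [|y s IH] b1 b2 x /=; first by rewrite addr0.
case/andP=> xy ys; have := IH (b1 (+) P y) (b2 (+) Q y) y ys.
by rewrite addbACA; case: b1; case: b2 => /=; lra.
Qed.

Lemma count_addb_odd P Q s :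
  odd (count (fun v => P v (+) Q v) s) = odd (count P s) (+) odd (count Q s).
Proof.
elim: s => //= y s IH.
by rewrite !oddD IH addbACA; case: (P y); case: (Q y).
Qed.

Lemma alt_addb P Q s : sorted <=%R s -> ~~ odd (count P s) ->
  ~~ odd (count Q s) ->
  alt (filter (fun v => P v (+) Q v) s) <= alt (filter P s) + alt (filter Q s).
Proof.
move=> srt evP evQ.
have ps : path <=%R (head 0 s) s by case: s srt {evP evQ} => //= y s ->; rewrite lexx.
have := gap_parity_addb false false P Q ps.
rewrite !gap_parityE //= count_addb_odd.
by rewrite (negbTE evP) (negbTE evQ).
Qed.

Lemma alt_ge0 s : sorted <=%R s -> 0 <= alt s.
Proof.
elim/seq_ind2: s => [||a b s IH] //= /andP[ab pbs].
by rewrite addr_ge0 ?subr_ge0 // IH // (path_sorted pbs).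
Qed.

Lemma sorted2_edge_cost (l : seq R) (e : {fset R}) :
  sorted <=%R l -> perm_eq l e -> #|` e| = 2%N -> alt l = edge_cost e.
Proof.
move=> srt pe; rewrite -(perm_size pe).
case: l srt pe => [|a [|b []]] //= /andP[ab _] pe _.
have -> : e = [fset a; b].
  by apply/fsetP => v; rewrite -(perm_mem pe) !inE.
by rewrite edge_cost2 addr0 ler0_norm ?opprB // subr_le0.
Qed.

(** [V] is the symmetric difference of the edges of [M], so subadditivity applies. The induction
    runs over lists of edges, with the points of odd degree in place of [V]. *)
Lemma alt_le_cost (V : {fset R}) (M : {fset {fset R}}) :
  perfect_matching V M -> alt (sort <=%R V) <= cost M.
Proof.
case=> Medge Mcov; set A := sort <=%R V.
have srtA : sorted <=%R A by apply: sort_sorted; exact: le_total.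
have edge e : e \in M -> alt (filter (mem e) A) = edge_cost e.
  case/Medge => /fsubsetP sub card2; apply: sorted2_edge_cost => //.
    apply: sorted_filter srtA; exact: le_trans.
  apply: uniq_perm => [||v]; rewrite ?filter_uniq ?sort_uniq ?fset_uniq //.
  by rewrite mem_filter mem_sort /=; case: (boolP (v \in e)) => // /sub ->.
have cnt e : e \in M -> count (mem e) A = 2%N.
  case/Medge => /fsubsetP sub <-; rewrite -size_filter; apply: perm_size.
  apply: uniq_perm => [||v]; rewrite ?filter_uniq ?sort_uniq ?fset_uniq //.
  by rewrite mem_filter mem_sort /=; case: (boolP (v \in e)) => // /sub ->.
pose odd_in (r : seq {fset R}) (v : R) :=
  odd (count (fun e : {fset R} => v \in e) r).
have ind (r : seq {fset R}) : {subset r <= M} ->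
    ~~ odd (count (odd_in r) A) /\
    alt (filter (odd_in r) A) <= \sum_(e <- r) edge_cost e.
  elim: r => [|e r IH] sub.
    rewrite big_nil (eq_filter (a2 := pred0)) ?filter_pred0 //.
    by rewrite (eq_count (a2 := pred0)) ?count_pred0.
  have eM : e \in M by rewrite sub ?mem_head.
  have [|ev le] := IH; first by move=> e' er; rewrite sub ?in_cons ?er ?orbT.
  have E : odd_in (e :: r) =1 (fun v => (v \in e) (+) odd_in r v).
    by move=> v; rewrite /odd_in /= oddD; case: (v \in e).
  rewrite (eq_count E) (eq_filter E) count_addb_odd cnt //=; split=> //.
  rewrite big_cons; apply: le_trans (alt_addb srtA _ ev) _; first by rewrite cnt.
  by rewrite edge // lerD2l.
have [_] := ind M (fun _ => id); rewrite (eq_in_filter (a2 := predT)) ?filter_predT //.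
move=> v; rewrite mem_sort => /Mcov [e [[eM ve] uni]].
rewrite /odd_in (eq_in_count (a2 := pred1 e)) ?count_uniq_mem ?fset_uniq ?eM //.
by move=> e' e'M /=; apply/idP/eqP => [ve'|->//]; rewrite (uni e').
Qed.

End AlternatingSum.

Lemma sum_pred1_seq (I : eqType) (V : nmodType) (r : seq I) i (F : I -> V) :
  uniq r -> i \in r -> \sum_(j <- r | j == i) F j = F i.
Proof. by move=> ur ir; rewrite -big_filter filter_pred1_uniq // big_seq1. Qed.

(** * Matchings that pair each label class in sorted order *)

Section LabelMatching.
Variable R : realType.
Implicit Types (s l : seq R) (V : {fset R}) (L : R -> nat).

Fixpoint mate l v : R :=
  if l is a :: l1 then
    if l1 is b :: l2 then
      if v == a then b else if v == b then a else mate l2 v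
    else v
  else v.

Lemma mate_in l v : ~~ odd (size l) -> v \in l -> mate l v \in l.
Proof.
elim/seq_ind2: l => [||a b l IH] //=; rewrite negbK => ev; rewrite !inE.
case: (v == a) => /=; first by rewrite eqxx orbT.
case: (v == b) => /=; first by rewrite eqxx.
by move=> vl; rewrite IH ?orbT.
Qed.

Lemma mate_neq l v : uniq l -> ~~ odd (size l) -> v \in l -> mate l v != v.
Proof.
elim/seq_ind2: l => [||a b l IH] //=; rewrite negbK !inE negb_or.
case/andP=> /andP[ab al] /andP[bl ul] ev.
case: eqP => [->|_] /=; first by rewrite eq_sym.
by case: eqP => [->|_] //= vl; rewrite IH.
Qed.

Lemma mateK l v : uniq l -> ~~ odd (size l) -> v \in l ->
  mate l (mate l v) = v.
Proof.
elim/seq_ind2: l => [||a b l IH] //=; rewrite negbK !inE negb_or.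
case/andP=> /andP[ab al] /andP[bl ul] ev.
case: eqP => [->|va] /=; first by rewrite eqxx eq_sym (negbTE ab).
case: eqP => [->|vb] /=; first by rewrite eqxx.
move=> vl; have ml := mate_in ev vl.
case: eqP => [E|_]; first by rewrite -E ml in al.
case: eqP => [E|_]; first by rewrite -E ml in bl.
exact: IH.
Qed.

(** This lets a program that knows only the indices find the partners. *)
Lemma index_mate l v : uniq l -> ~~ odd (size l) -> v \in l ->
  index (mate l v) l =
    (if odd (index v l) then (index v l).-1 else (index v l).+1).
Proof.
elim/seq_ind2: l => [||a b l IH] //=; rewrite negbK !inE negb_or.
case/andP=> /andP[ab al] /andP[bl ul] ev.
rewrite ![_ == v]eq_sym.
case: eqP => [->|va] /=; first by rewrite (negbTE ab) eqxx.
case: eqP => [->|vb] /=; first by rewrite eqxx.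
move=> vl; have ml := mate_in ev vl.
case: eqP => [E|_]; first by rewrite E ml in al.
case: eqP => [E|_]; first by rewrite E ml in bl.
by rewrite IH // negbK; case: ifP => //; case: (index v l).
Qed.

Lemma sum_mate l : uniq l -> sorted <=%R l -> ~~ odd (size l) ->
  \sum_(v <- l) `|v - mate l v| = alt l * 2.
Proof.
elim/seq_ind2: l => [_ _ _||a b l IH]; first by rewrite big_nil mul0r.
  by [].
rewrite [uniq _]/= [sorted _ _]/= [odd _]/= negbK !inE negb_or.
case/andP=> /andP[ab al] /andP[bl ul] /andP[leab pbl] ev.
rewrite !big_cons [mate _ a]/= [mate _ b]/= !eqxx [b == a]eq_sym (negbTE ab).
rewrite big_seq (eq_bigr (fun v => `|v - mate l v|)) -?big_seq.
  rewrite IH ?(path_sorted pbl) //= ler0_norm ?ger0_norm ?subr_ge0 ?subr_le0 //.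
  by rewrite mulrDl; ring.
move=> v vl /=; case: eqP => [E|_]; first by rewrite -E vl in al.
by case: eqP => [E|_] //; rewrite -E vl in bl.
Qed.

(** Each edge arises from both of its ends, whence the division by 2. *)
Lemma involution_matching V (pi : R -> R) :
  (forall v, v \in V -> [/\ pi v \in V, pi v != v & pi (pi v) = v]) ->
  let M := [fset [fset v; pi v] | v in V] in
  perfect_matching V M /\ cost M = (\sum_(v <- V) `|v - pi v|) / 2.
Proof.
move=> piP M.
have edgeE u v : u \in V -> v \in V -> (v \in [fset u; pi u]) ->
    [fset u; pi u] = [fset v; pi v].
  move=> uV vV; rewrite !inE => /orP[/eqP->//|/eqP->].
  by have [_ _ ->] := piP u uV; rewrite fsetUC.
split.
  split=> [e /imfsetP[v /= vV ->]|v vV].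
    have [pV ne _] := piP v vV; split; last by rewrite cardfs2 eq_sym ne.
    by apply/fsubsetP => w; rewrite !inE => /orP[] /eqP ->.
  exists [fset v; pi v]; split.
    by split; [apply/imfsetP; exists v|rewrite !inE eqxx].
  by move=> e [/imfsetP[u /= uV ->] ve]; apply/esym/edgeE.
have -> : \sum_(v <- V) `|v - pi v| =
    \sum_(v <- V) \sum_(e <- M | e == [fset v; pi v]) edge_cost e.
  rewrite big_seq [RHS]big_seq; apply: eq_bigr => v vV.
  rewrite sum_pred1_seq ?edge_cost2 ?fset_uniq //.
  by apply/imfsetP; exists v.
rewrite (exchange_big_dep xpredT) //= /cost mulr_suml big_seq [RHS]big_seq.
apply: eq_bigr => e /imfsetP[u /= uV ->].
have [pV ne _] := piP u uV.
rewrite -big_filter (perm_big [:: u; pi u]); last first.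
  apply: uniq_perm => [||v]; rewrite ?filter_uniq ?fset_uniq //.
    by rewrite /= inE eq_sym ne.
  rewrite mem_filter !inE.
  apply/andP/idP => [[/eqP E vV]|].
    have : v \in [fset u; pi u] by rewrite E !inE eqxx.
    by rewrite !inE.
  move=> vu; have vV : v \in V by case/orP: vu => /eqP ->.
  by split=> //; apply/eqP/edgeE; rewrite // !inE.
rewrite !big_cons big_nil /=.
by rewrite addr0 mulrDl -splitr.
Qed.

Definition label_class V L v := filter (fun w => L w == L v) (sort <=%R V).

Definition label_mate V L v := mate (label_class V L v) v.

Definition label_matching V L : {fset {fset R}} :=
  [fset [fset v; label_mate V L v] | v in V].

(** Even classes make [label_mate] a fixed-point-free involution that preserves labels; [B] serves
    to write the cost as a finite sum over labels. *)
Lemma label_matchingP V L B :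
  (forall v, v \in V -> (L v < B)%N) ->
  (forall j, ~~ odd (count (fun v => L v == j) (sort <=%R V))) ->
  perfect_matching V (label_matching V L) /\
  cost (label_matching V L) =
    \sum_(0 <= j < B) alt (filter (fun v => L v == j) (sort <=%R V)).
Proof.
move=> LB ev; set A := sort <=%R V.
have uA : uniq A by rewrite sort_uniq fset_uniq.
have srtA : sorted <=%R A by apply: sort_sorted; exact: le_total.
have uC v : uniq (label_class V L v) by rewrite filter_uniq.
have evC v : ~~ odd (size (label_class V L v)) by rewrite size_filter.
have inC v : v \in V -> v \in label_class V L v.
  by move=> vV; rewrite mem_filter eqxx mem_sort.
have mC v : v \in V -> label_mate V L v \in label_class V L v.
  by move=> vV; exact: mate_in (evC v) (inC v vV).
have [|pm ->] := @involution_matching V (label_mate V L).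
  move=> v vV; have := mC v vV; rewrite mem_filter mem_sort => /andP[/eqP LE mV].
  split=> //; first exact: mate_neq (uC v) (evC v) (inC v vV).
  rewrite /label_mate /label_class -/(label_class V L v) -/(label_mate V L v) LE.
  exact: mateK (uC v) (evC v) (inC v vV).
split=> //.
have -> : \sum_(v <- V) `|v - label_mate V L v| =
    \sum_(v <- A) \sum_(0 <= j < B | j == L v) `|v - label_mate V L v|.
  rewrite (perm_big A) /=; last by rewrite perm_sym; exact: permEl (perm_sort _ _).
  rewrite big_seq [RHS]big_seq; apply: eq_bigr => v; rewrite mem_sort => vV.
  by rewrite sum_pred1_seq ?iota_uniq // mem_index_iota LB.
rewrite (exchange_big_dep xpredT) //= mulr_suml; apply: eq_bigr => j _.
rewrite -big_filter (eq_filter (a2 := fun v => L v == j)); last first.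
  by move=> v; rewrite eq_sym.
rewrite big_seq (eq_bigr (fun v => `|v - mate (filter (fun v => L v == j) A) v|)).
  rewrite -big_seq sum_mate ?filter_uniq ?size_filter ?mulfK ?pnatr_eq0 //.
  apply: sorted_filter srtA; exact: le_trans.
by move=> v; rewrite mem_filter => /andP[/eqP <- _].
Qed.

End LabelMatching.

(** * Cheapest partial matchings *)

Section Selection.
Variable R : realType.

(** The last index is the weight of [j] disjoint pairs of neighbours in the list. Covered points get
    deleted from the list, so that the ends of an augmenting path are neighbours as well. *)
Inductive selection (T : Type) (w : T -> T -> R) : seq T -> nat -> R -> Prop :=
  | selection0 s : selection w s 0 0
  | selection_skip a s j x : selection w s j x -> selection w (a :: s) j x
  | selection_take a b s j x :
      selection w s j x -> selection w (a :: b :: s) j.+1 (w a b + x).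

Lemma selection0_eq0 (T : Type) (w : T -> T -> R) s x :
  selection w s 0 x -> x = 0.
Proof. by elim: s x => [|a s IH] x H; inversion H; subst=> //; apply: IH. Qed.

Lemma selection_drop (T : Type) (w : T -> T -> R) m s j x :
  sorted (fun a b => m <= w a b) s -> selection w s j.+1 x ->
  exists2 y, selection w s j y & y + m <= x.
Proof.
move=> + H; move E: j.+1 H => k H.
elim: H j E => {s k x} [//|a s k x _ IH|a b s k x H _] j E srt.
  have [|y H le] := IH j E; first exact: path_sorted srt.
  by exists y => //; exact: selection_skip.
move: srt => /= /andP[mw _]; case: E => ->.
by exists x; [do 2![apply: selection_skip]|rewrite addrC lerD2r].
Qed.

Lemma selection_leq (T : Type) (w : T -> T -> R) s i j x :
  sorted (fun a b => 0 <= w a b) s -> selection w s j x -> (i <= j)%N ->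
  exists2 y, selection w s i y & y <= x.
Proof.
move=> srt; elim: j x => [|j IH] x H; first by rewrite leqn0 => /eqP ->; exists x.
rewrite leq_eqVlt => /orP[/eqP -> |]; first by exists x.
have [y Hy le] := selection_drop srt H.
case/(IH _ Hy) => y' ? ?; exists y' => //; lra.
Qed.

Lemma selection_map (T U : Type) (h : T -> U) (w : U -> U -> R) s j x :
  selection w (map h s) j x -> selection (fun a b => w (h a) (h b)) s j x.
Proof.
move E: (map h s) => t H; elim: H s E => {t j x} [t|a t j x _ IH|a b t j x _ IH] s.
- by move=> _; exact: selection0.
- by case: s => //= a' s [_ /IH]; exact: selection_skip.
- by case: s => [|a' [|b' s]] //= [<- <- /IH]; exact: selection_take.
Qed.

Lemma selection_eq (T : eqType) (w w' : T -> T -> R) s j x :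
  sorted (fun a b => w a b == w' a b) s -> selection w s j x -> selection w' s j x.
Proof.
move=> srt H; elim: H srt => {s j x} [s|a s j x _ IH|a b s j x _ IH] srt.
- exact: selection0.
- exact/selection_skip/IH/(path_sorted srt).
- move: srt => /= /andP[/eqP -> srt].
  exact/selection_take/IH/(path_sorted srt).
Qed.

Section Contraction.
Variables (T : Type) (z : T -> R).
Let w a b := z a + z b.

(* An optimal selection contains p, q or can be rerouted around them: since  *)
(* w x y = w x p - w p q + w q y, using both (x, p) and (q, y) amounts to    *)
(* using p, q and x, y.                                                      *)
Lemma selection_contract s1 p q s2 j x :
  sorted (fun a b => w p q <= w a b) (s1 ++ p :: q :: s2) ->
  selection w (s1 ++ p :: q :: s2) j.+1 x ->
  exists2 y, selection w (s1 ++ s2) j y & y + w p q <= x.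
Proof.
elim: {s1}(size s1).+1 {-2}s1 (ltnSn (size s1)) j x => // n IH [|a s1] lt j x srt.
  move: (srt) => /= /andP[_ srt2] H.
  inversion H as [|? ? ? ? H1|? ? ? ? y H1]; subst; last first.
    by exists y; [|rewrite addrC].
  inversion H1 as [|? ? ? ? H2|? b s ? y H2]; subst.
    exact: selection_drop (path_sorted srt2) H2.
  exists y; first exact: selection_skip.
  by move: srt2 => /= /andP[]; rewrite addrC lerD2r.
move=> H; inversion H as [|? ? ? ? H1|? b s ? y H1 [E0 E1]]; subst.
  have [|y Hy le] := IH s1 lt _ _ _ H1; first exact: path_sorted srt.
  by exists y => //; exact: selection_skip.
case: s1 lt srt {H} E1 => [|b' s1] lt srt /= [? ?]; subst.
  case: j H1 => [/selection0_eq0 ->|j H1].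
    exists 0; [exact: selection0|rewrite add0r addr0].
    by case/andP: srt.
  inversion H1 as [|? ? ? ? H2|? c s ? y2 H2]; subst.
    exists y; first exact: selection_skip.
    by case/andP: srt => le _; rewrite addrC lerD2r.
  exists (w a c + y2); first exact: selection_take.
  by rewrite /w; lra.
case: j H1 => [/selection0_eq0 ->|j H1].
  exists 0; [exact: selection0|rewrite add0r addr0].
  by case/andP: srt.
have [||y2 H2 le] := IH s1 _ _ _ _ H1; first by rewrite /= in lt; lia.
  exact: path_sorted (path_sorted srt).
exists (w a b' + y2); first exact: selection_take.
by rewrite -addrA lerD2l.
Qed.

(** The new neighbours a, b have weight w a p - w p q + w q b, which is at least w p q. Successive
    augmentations therefore never get cheaper, and weights stay nonnegative. *)
Lemma sorted_contract s1 p q s2 :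
  sorted (fun a b => w p q <= w a b) (s1 ++ p :: q :: s2) ->
  sorted (fun a b => w p q <= w a b) (s1 ++ s2).
Proof.
elim: s1 => [|a [|b s1] IH] /=; first by case/andP=> _ /path_sorted.
  case/and3P=> lap _; case: s2 {IH} => //= b s2 /andP[lqb ->].
  by rewrite andbT; move: lap lqb; rewrite /w; lra.
by case/andP=> -> /IH.
Qed.

End Contraction.

(** Keep the pairs of the sorted pairing with both ends in [Q]; they remain neighbours after
    filtering. Every lost pair contains a point outside [Q], and the final successor allows for odd
    length. *)
Lemma selection_alt (Q : pred R) A : sorted <=%R A ->
  exists j y, [/\ selection (fun a b => b - a) (filter Q A) j y, y <= alt A &
                  (size A <= (j + count (predC Q) A).*2.+1)%N].
Proof.
elim/seq_ind2: A => [_|a _|a b A IH].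
- by exists 0%N, 0; split=> //; exact: selection0.
- by exists 0%N, 0; split=> //; exact: selection0.
rewrite [sorted _ _]/= => /andP[ab srt]; have [|j [y [H le sz]]] := IH.
  exact: path_sorted srt.
move: sz; set n := count _ A; set m := size A => sz; rewrite /= -/n -/m.
case: (Q a); case: (Q b) => /=; rewrite ?add0n.
- exists j.+1, (b - a + y); split; [exact: selection_take|by rewrite lerD2l|lia].
- exists j, y; split; [exact: selection_skip|by lra|lia].
- exists j, y; split; [exact: selection_skip|by lra|lia].
- exists j, y; split; [by []|by lra|lia].
Qed.

End Selection.

(** * The greedy augmentations: optimality and structure of the covered set *)

Section Greedy.
Variables (R : realType) (x : nat -> R) (N : nat).
Hypothesis x_mono : forall p q, (p <= q)%N -> (q < N)%N -> x p <= x q.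

(* Between consecutive uncovered positions p < q the covered ones form        *)
(* adjacent pairs, and pot p + pot q is the cost of augmenting from p to q:   *)
(* the alternating sum of the gaps between them.                              *)
Fixpoint pot (p : nat) : R :=
  if p is p1.+1 then x p - x p1 - pot p1 else 0.

(* The state is (l + 1, p, q + 1, pot p + pot q) with l the last position    *)
(* read and p, q the best pair found; 0 stands for "none".                   *)
Definition scan_step (st : nat * nat * nat * R) (p : nat) :=
  let '(l, bp, bq, bv) := st in
  if l == 0%N then (p.+1, bp, bq, bv)
  else if (bq == 0%N) || (pot l.-1 + pot p < bv) then
    (p.+1, l.-1, p.+1, pot l.-1 + pot p)
  else (p.+1, bp, bq, bv).

Definition scan (u : seq nat) := foldl scan_step (0%N, 0%N, 0%N, 0) u.

Lemma scanP u : (1 < size u)%N ->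
  exists l u1 p q u2, [/\ u = u1 ++ p :: q :: u2,
    scan u = (l, p, q.+1, pot p + pot q) &
    sorted (fun a b => pot p + pot q <= pot a + pot b) u].
Proof.
case: u => [|p0 [|q0 r]] // _.
suff [u1 [p [q [u2 [-> E srt]]]]] : exists u1 p q u2,
    [/\ p0 :: q0 :: r = u1 ++ p :: q :: u2,
    scan (p0 :: q0 :: r) = ((last q0 r).+1, p, q.+1, pot p + pot q) &
    sorted (fun a b => pot p + pot q <= pot a + pot b) (p0 :: q0 :: r)].
  by exists (last q0 r).+1, u1, p, q, u2.
elim/last_ind: r => [|r a [u1 [p [q [u2 [Eu E srt]]]]]].
  by exists [::], p0, q0, [::]; rewrite /= lexx.
rewrite /scan -!rcons_cons foldl_rcons -/(scan _) E /=.
rewrite last_rcons; case: ltP => [lt|ge].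
  exists (belast p0 (q0 :: r)), (last q0 r), a, [::].
  split=> //; first by rewrite -cat_rcons -lastI cats1.
  rewrite rcons_path lexx andbT; have /= /andP[le pr] := srt.
  rewrite (le_trans (ltW lt) le) /=.
  by apply: sub_path pr => i j; exact: (le_trans (ltW lt)).
exists u1, p, q, (rcons u2 a); split=> //.
  by rewrite -!rcons_cons Eu -rcons_cat.
by rewrite rcons_path ge andbT.
Qed.

(* The step at which each position is covered (0: not yet), and the cost.    *)
Fixpoint greedy (j : nat) : (nat -> nat) * R :=
  if j is j1.+1 then
    let '(f, c) := greedy j1 in
    let '(_, bp, bq, bv) := scan [seq p <- iota 0 N | f p == 0%N] in
    (fun p => if (p == bp) || (p == bq.-1) then j else f p, c + bv)
  else (fun=> 0%N, 0).

Definition step j := (greedy j).1.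
Definition gcost j := (greedy j).2.
Definition uncov j := [seq p <- iota 0 N | step j p == 0%N].

Let w a b := pot a + pot b.

Lemma greedyS j : (1 < size (uncov j))%N ->
  exists u1 p q u2,
    [/\ uncov j = u1 ++ p :: q :: u2,
        step j.+1 =1 (fun r => if (r == p) || (r == q) then j.+1 else step j r),
        gcost j.+1 = gcost j + w p q,
        uncov j.+1 = u1 ++ u2 &
        sorted (fun a b => w p q <= w a b) (uncov j)].
Proof.
move=> sz; have [l [u1 [p [q [u2 [Eu Es srt]]]]]] := scanP sz.
have Ef : step j.+1 =1 (fun r => if (r == p) || (r == q) then j.+1 else step j r).
  by rewrite /step /=; move: Es; rewrite /uncov /step; case: (greedy j) => f c /= ->.
exists u1, p, q, u2; split=> //.
  by rewrite /gcost /=; move: Es; rewrite /uncov /step; case: (greedy j) => f c /= ->.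
have -> : uncov j.+1 = [seq r <- uncov j | (r != p) && (r != q)].
  rewrite /uncov -filter_predI; apply: eq_filter => r /=; rewrite Ef -negb_or.
  by case: ifP.
have : uniq (uncov j) by rewrite filter_uniq ?iota_uniq.
rewrite Eu cat_uniq /= !inE !negb_or.
case/and3P=> _ /and3P[pu1 qu1 _] /and3P[/andP[pq pu2] qu2 _].
rewrite filter_cat /= !eqxx andbF /=; congr (_ ++ _).
  apply/all_filterP/allP => r ru; apply/andP; split.
    by apply: contraNneq pu1 => <-.
  by apply: contraNneq qu1 => <-.
apply/all_filterP/allP => r ru; apply/andP; split.
  by apply: contraNneq pu2 => <-.
by apply: contraNneq qu2 => <-.
Qed.

Lemma size_uncov j : (j.*2 <= N)%N -> size (uncov j) = (N - j.*2)%N.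
Proof.
elim: j => [|j IH] le.
  by rewrite /uncov /step /= filter_predT size_iota subn0.
have sz : size (uncov j) = (N - j.*2)%N by rewrite IH; lia.
have [|u1 [p [q [u2 [E _ _ E' _]]]]] := @greedyS j; first by rewrite sz; lia.
by move: sz; rewrite E E' !size_cat /=; lia.
Qed.

Lemma greedyS_half j : (j.+1.*2 <= N)%N ->
  exists u1 p q u2,
    [/\ uncov j = u1 ++ p :: q :: u2,
        step j.+1 =1 (fun r => if (r == p) || (r == q) then j.+1 else step j r),
        gcost j.+1 = gcost j + w p q,
        uncov j.+1 = u1 ++ u2 &
        sorted (fun a b => w p q <= w a b) (uncov j)].
Proof. by move=> le; apply: greedyS; rewrite size_uncov; lia. Qed.

(** Before the first step augmenting just means joining neighbours, so [gcost_opt] applies to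
    ordinary matchings. *)
Lemma sorted_gap : sorted (fun a b => x b - x a == w a b) (iota 0 N).
Proof.
have gap m k : path (fun a b => x b - x a == w a b) m (iota m.+1 k).
  elim: k m => //= k IH m; rewrite IH andbT /w /=; apply/eqP; ring.
by case: N => // n /=; exact: gap.
Qed.

Lemma sorted_iota_ge0 : sorted (fun a b => 0 <= w a b) (iota 0 N).
Proof.
have gap m k : (m + k < N)%N -> path (fun a b => 0 <= w a b) m (iota m.+1 k).
  elim: k m => //= k IH m lt; rewrite IH; last by lia.
  have : x m <= x m.+1 by apply: x_mono; lia.
  by rewrite andbT /w /=; lra.
case: N gap => // n gap /=; apply: gap; lia.
Qed.

Lemma uncov_ge0 j : (j.*2 <= N)%N -> sorted (fun a b => 0 <= w a b) (uncov j).
Proof.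
elim: j => [|j IH] le.
  by rewrite /uncov /step /= filter_predT sorted_iota_ge0.
have := IH; have [u1 [p [q [u2 [-> _ _ -> srt]]]]] := greedyS_half le.
move=> /(_ _)/cat_sorted2 [|_ /= /andP[ge0 _]]; first by lia.
by apply: sub_sorted (sorted_contract srt) => a b; apply: le_trans.
Qed.

Lemma gcost_le j : (j.+1.*2 <= N)%N -> gcost j <= gcost j.+1.
Proof.
move=> le; have := @uncov_ge0 j; have [u1 [p [q [u2 [-> _ -> _ _]]]]] := greedyS_half le.
move=> /(_ _)/cat_sorted2 [|_ /= /andP[ge0 _]]; first by lia.
by rewrite lerDl.
Qed.

Lemma gcost_ge0 j : (j.*2 <= N)%N -> 0 <= gcost j.
Proof.
elim: j => // j IH le; apply: le_trans (gcost_le le); apply: IH; lia.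
Qed.

(** The start [i] is arbitrary because the induction advances it: [selection_contract] turns the
    competitor into one with a pair fewer among the positions left by the next greedy step. *)
Lemma gcost_opt i j y : ((i + j).*2 <= N)%N -> selection w (uncov i) j y ->
  gcost (i + j) <= gcost i + y.
Proof.
elim: j i y => [|j IH] i y le H.
  by rewrite addn0 (selection0_eq0 H) addr0.
have [|u1 [p [q [u2 [E _ Ec E' srt]]]]] := @greedyS_half i; first by lia.
rewrite E in H srt; have [y' Hy' ley'] := selection_contract srt H.
rewrite -addSnnS; apply: le_trans (IH i.+1 y' _ _) _; [lia|by rewrite E'|].
by move: ley'; rewrite Ec /w; lra.
Qed.

(** Common bookkeeping for [count_step], [gcost_sum] and [even_count_step], which differ in [F] and
    in the range [r]. *)
Lemma sum_step (V : nmodType) j p q r (F : nat -> nat -> V) :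
  uniq r -> p != q -> step j p = 0%N -> step j q = 0%N ->
  step j.+1 =1 (fun r => if (r == p) || (r == q) then j.+1 else step j r) ->
  \sum_(i <- r | step j.+1 i != 0%N) F (step j.+1 i) i =
  \sum_(i <- r | step j i != 0%N) F (step j i) i +
    ((if p \in r then F j.+1 p else 0) + (if q \in r then F j.+1 q else 0)).
Proof.
move=> + pq p0 q0 E; elim: r => [|i r IH] /=; first by rewrite !big_nil !addr0.
case/andP=> ir /IH {}IH; rewrite !big_cons !inE E.
case: (eqVneq i p) => [Ei|ip] /=.
  rewrite Ei p0 eqxx [q == p]eq_sym (negbTE pq) /= IH.
  by rewrite -Ei (negbTE ir) add0r addrCA.
case: (eqVneq i q) => [Ei|iq] /=.
  rewrite Ei q0 eqxx /= IH.
  by rewrite -Ei (negbTE ir) addr0 [RHS]addrA [RHS]addrC.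
by rewrite IH; case: ifP => // _; rewrite addrA.
Qed.

Lemma uncovP j u1 p q u2 : uncov j = u1 ++ p :: q :: u2 ->
  [/\ p \in iota 0 N, q \in iota 0 N, p != q, step j p = 0%N & step j q = 0%N].
Proof.
move=> E; have : uniq (uncov j) by rewrite filter_uniq ?iota_uniq.
have : p \in uncov j by rewrite E mem_cat !inE eqxx orbT.
have : q \in uncov j by rewrite E mem_cat !inE eqxx !orbT.
rewrite E cat_uniq /= !inE !negb_or -E !mem_filter.
by case/andP=> /eqP -> -> /andP[/eqP -> ->] /and3P[_ _ /andP[/andP[-> _] _]].
Qed.

Lemma count_step j (P : pred nat) : (j.*2 <= N)%N ->
  count (fun i => (step j i != 0%N) && P (step j i)) (iota 0 N) =
  (count P (iota 1 j)).*2.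
Proof.
have sumE k : count (fun i => (step k i != 0%N) && P (step k i)) (iota 0 N) =
    (\sum_(i <- iota 0 N | step k i != 0%N) (P (step k i) : nat))%N.
  by rewrite -sum1_count big_mkcondr /=; apply: eq_bigr => i _; case: (P _).
rewrite sumE; elim: j => [|j IH] le.
  by rewrite big1 // => i; rewrite /step.
have [u1 [p [q [u2 [E Es _ _ _]]]]] := greedyS_half le.
have [pN qN pq p0 q0] := uncovP E.
have := sum_step (fun k _ => (P k : nat)) (iota_uniq 0 N) pq p0 q0 Es.
rewrite pN qN => ->; rewrite IH; last by lia.
rewrite -[j.+1 in RHS]addn1 iotaD count_cat /= add1n addn0.
by rewrite doubleD; congr (_ + _)%N; exact: addnn.
Qed.

Lemma gcost_sum j : (j.*2 <= N)%N ->
  gcost j = \sum_(i <- iota 0 N | step j i != 0%N) pot i.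
Proof.
elim: j => [|j IH] le; first by rewrite big1 // => i; rewrite /step.
have [u1 [p [q [u2 [E Es -> _ _]]]]] := greedyS_half le.
have [pN qN pq p0 q0] := uncovP E.
rewrite (sum_step (fun _ => pot) (iota_uniq 0 N) pq p0 q0 Es) pN qN IH //.
lia.
Qed.

(** The two positions covered by a step are neighbours among the uncovered ones, hence on the same
    side of [v]. *)
Lemma even_count_step j v : (j.*2 <= N)%N -> (v < N)%N -> step j v = 0%N ->
  ~~ odd (count (fun i => step j i != 0%N) (iota 0 v)).
Proof.
have sumE k : count (fun i => step k i != 0%N) (iota 0 v) =
    (\sum_(i <- iota 0 v | step k i != 0%N) 1)%N by rewrite sum1_count.
move=> + vN; elim: j => [|j IH] le.
  by rewrite (eq_count (a2 := pred0)) // count_pred0.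
have [u1 [p [q [u2 [E Es _ E' _]]]]] := greedyS_half le.
have [pN qN pq p0 q0] := uncovP E; move=> v0.
have vu : v \in uncov j.+1 by rewrite mem_filter v0 mem_iota.
have {}v0 : step j v = 0%N by move: v0; rewrite Es; case: ifP.
have := sum_step (fun _ _ => 1%N) (iota_uniq 0 v) pq p0 q0 Es.
rewrite -!sumE => ->; rewrite oddD (negbTE (IH _ v0)) /=; last by lia.
suff -> : (q \in iota 0 v) = (p \in iota 0 v) by case: ifP.
have : sorted ltn (uncov j).
  by apply: sorted_filter (iota_ltn_sorted _ _); exact: ltn_trans.
rewrite E (sorted_pairwise ltn_trans) pairwise_cat => /and3P[/allrelP u1pq _].
move=> /= /and3P[/andP[_ /allP pu2] /allP qu2 _].
rewrite !mem_iota !add0n /=.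
move: vu; rewrite E' mem_cat => /orP[vu|vu].
  have := u1pq v p vu; have := u1pq v q vu; rewrite !inE !eqxx orbT /=.
  by move=> /(_ isT) + /(_ isT); lia.
by have := pu2 v vu; have := qu2 v vu; rewrite /=; lia.
Qed.

(** The flag [b] says that position [m.-1] awaits its partner. By the parity hypothesis the next
    position is then covered, and the gap between the two is the sum of their potentials. *)
Lemma alt_covered (C : pred nat) m k (b : bool) : (b -> 0 < m)%N ->
  (forall v, (v < k)%N -> ~~ C (m + v)%N ->
     ~~ (b (+) odd (count C (iota m v)))) ->
  ~~ (b (+) odd (count C (iota m k))) ->
  alt ((if b then [:: x m.-1] else [::]) ++ map x (filter C (iota m k))) =
  (if b then pot m.-1 else 0) + \sum_(i <- iota m k | C i) pot i.
Proof.
elim: k m b => [|k IH] m b m0 ev /=.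
  by case: b m0 ev => //= *; rewrite big_nil addr0.
have ev' b' : b' = b (+) C m -> forall v, (v < k)%N -> ~~ C (m.+1 + v)%N ->
     ~~ (b' (+) odd (count C (iota m.+1 v))).
  move=> -> v vk; rewrite addSnnS => nC; have := ev v.+1 vk nC.
  by rewrite /= oddD addbA; case: (C m).
rewrite oddD addbA big_cons; case Cm: (C m) in ev' *; last first.
  have := ev 0%N isT; rewrite addn0 Cm => /(_ isT).
  case: b {ev m0} ev' => //= ev' _ tot.
  by rewrite add0r (IH m.+1 false) // ?add0r //; apply: ev'.
case: b m0 {ev} ev' => /= [/(_ isT) m0|_] ev' tot.
  rewrite (IH m.+1 false) // ?add0r; last exact: ev'.
  case: m m0 {IH ev' Cm tot} => //= m _; ring.
rewrite add0r; apply: (IH m.+1 true) => //; exact: ev'.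
Qed.

Lemma gcost_alt j : ~~ odd N -> (j.*2 <= N)%N ->
  gcost j = alt (map x [seq p <- iota 0 N | step j p != 0%N]).
Proof.
move=> evN le; rewrite gcost_sum //.
have H := @alt_covered (fun p => step j p != 0%N) 0 N false.
rewrite /= add0r in H; rewrite H // => [v vN|].
  by rewrite negbK => /eqP; apply: even_count_step.
have := count_step predT le; rewrite (eq_count (a2 := fun p => step j p != 0%N)).
  by move=> ->; rewrite odd_double.
by move=> i; rewrite /= andbT.
Qed.

Lemma step_leq j p : (step j p <= j)%N.
Proof.
elim: j => [|j IH] //; rewrite /step /= -/(step _ _).
move: IH; rewrite /step; case: (greedy j) => f c /= IH.
by case: (scan _) => [[[_ bp] bq] bv] /=; case: ifP => // _; exact: leqW.
Qed.

(** Step numbers are never revised, so all intermediate stages can be read off the final one. *)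
Lemma step_stable j m p : (j <= m)%N -> (m.*2 <= N)%N ->
  (step j p != 0%N) = (step m p != 0%N) && (step m p <= j)%N.
Proof.
move=> jm; rewrite -(subnK jm); elim: (m - j)%N => [|d IH] le.
  by rewrite step_leq andbT.
have [u1 [a [b [u2 [E Es _ _ _]]]]] := greedyS_half le.
have [_ _ _ a0 b0] := uncovP E.
rewrite IH ?addSn ?Es; last by move: le; rewrite addSn; lia.
by case: ifP => // /orP[] /eqP ->; rewrite ?a0 ?b0 -addSn; lia.
Qed.

Lemma step_half j p : j.*2 = N -> (p < N)%N -> (0 < step j p <= j)%N.
Proof.
move=> E pN; rewrite step_leq andbT lt0n; apply/eqP => p0.
have : size (uncov j) = 0%N by rewrite size_uncov E ?subnn.
move/size0nil => U; have : p \in uncov j by rewrite mem_filter p0 mem_iota.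
by rewrite U.
Qed.

End Greedy.

(** * Levels *)

Section Levels.
Variables (R : realType) (c : nat -> R) (n : nat).

Definition level_step (st : nat * R) (j : nat) : nat * R :=
  if c j + c j <= st.2 then (st.1.+1, c j) else st.

(* The steps are visited downwards, and a new level is opened when the cost  *)
(* has dropped to one half.                                                  *)
Fixpoint level_state (i : nat) : nat * R :=
  if i is i1.+1 then level_step (level_state i1) (n - i1) else (0%N, c n).

Definition level (j : nat) : nat := (level_state (n - j).+1).1.

Lemma level_stateS j : (j < n)%N -> level_state (n - j) = level_state (n - j.+1).+1.
Proof. by move=> lt; congr level_state; lia. Qed.

Lemma level_afterE j : (j <= n)%N ->
  level_state (n - j).+1 = level_step (level_state (n - j)) j.
Proof. by move=> le /=; congr level_step; lia. Qed.

Lemma level_anti i j : (i <= j)%N -> (level j <= level i)%N.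
Proof.
have mono k m : (k <= m)%N -> ((level_state k).1 <= (level_state m).1)%N.
  elim: m => [|m IH]; first by rewrite leqn0 => /eqP ->.
  rewrite leq_eqVlt => /orP[/eqP -> //|/IH le]; apply: leq_trans le _.
  by rewrite /= /level_step; case: ifP.
by move=> le; apply: mono; lia.
Qed.

(* K P is the cost of the points whose step satisfies P.                     *)
Variables (K : pred nat -> R) (B : nat).
Hypothesis c0 : c 0%N = 0.
Hypothesis c_ge0 : forall j, (j <= n)%N -> 0 <= c j.
Hypothesis K_ext : forall P Q : pred nat,
  (forall i, (0 < i <= n)%N -> P i = Q i) -> K P = K Q.
Hypothesis K_pred0 : K pred0 = 0.
Hypothesis K_seg : forall e j, (e <= j)%N -> (j <= n)%N ->
  K (fun i => (e < i <= j)%N) <= c e + c j.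

Let bound j :=
  \sum_(0 <= t < B) K (fun i => (i <= j)%N && (level i == t)) <= 3 * c j.

(** With [st] the state before [j] is visited, [e] is the first step from [j] downwards that opens a
    new level. *)
Let below j (st : nat * R) := exists e,
  [/\ (e <= j)%N, forall i, (e < i <= j)%N -> level i = st.1,
      level e = st.1.+1, c e + c e <= st.2 & bound e].

(** The level opened at [j] costs at most c e + c j and the levels from [e] down at most 3 c e. As 2
    c e <= c j, the sum is at most 3 c j: the factor 3 turns the geometric series into an
    invariant. *)
Let bound_of_below j : (j <= n)%N -> (level_state (n - j).+1).2 = c j ->
  (j = 0%N \/ exists2 k, j = k.+1 & below k (level_state (n - k))) -> bound j.
Proof.
move=> jn Ecu [->|[k Ej [e [ek lev_e e1 half bnd]]]].
  rewrite /bound big1 ?c0 ?mulr0 // => t _.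
  by rewrite -[RHS]K_pred0; apply: K_ext => i; case: i.
have Est : level_state (n - k) = level_state (n - j).+1.
  by rewrite level_stateS ?Ej //; lia.
rewrite Est in lev_e e1 half; rewrite -/(level j) Ecu in half lev_e e1.
have lev_ej i : (e < i <= j)%N -> level i = level j.
  case/andP=> ei; rewrite leq_eqVlt => /orP[/eqP -> //|ij].
  by apply: lev_e; lia.
have C_ge0 : 0 <= c e + c j by rewrite addr_ge0 ?c_ge0 //; lia.
have le t : K (fun i => (i <= j)%N && (level i == t)) <=
    K (fun i => (i <= e)%N && (level i == t)) +
    (if t == level j then c e + c j else 0).
  case: eqP => [->|tj].
    rewrite [X in _ <= X + _](_ : _ = 0) ?add0r.
      apply: le_trans (K_seg _ jn); last by lia.
      rewrite le_eqVlt; apply/orP; left; apply/eqP/K_ext => i _.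
      case: (leqP i e) => ie /=; last first.
        by case: leqP => //= ij; rewrite lev_ej ?eqxx // ie.
      by have := level_anti ie; rewrite e1 andbC; case: eqP => //; lia.
    rewrite -[RHS]K_pred0; apply: K_ext => i _ /=.
    case: leqP => //= ie; have := level_anti ie; rewrite e1.
    by case: eqP => // ->; rewrite ltnn.
  rewrite addr0 le_eqVlt; apply/orP; left; apply/eqP/K_ext => i _.
  case: (leqP i e) => ie /=; first by rewrite (leq_trans ie) //; lia.
  case: leqP => //= ij; rewrite lev_ej ?ie //.
  by apply/eqP => E; rewrite E in tj.
rewrite /bound; apply: le_trans (ler_sum _ (fun t _ => le t)) _.
rewrite big_split /= -big_mkcond big_nat1_eq.
move: bnd; rewrite /bound; case: ifP => _; have := c_ge0 jn; lra.
Qed.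

Let state_ge0 i : 0 <= (level_state i).2.
Proof.
elim: i => [|i IH] /=; first exact: c_ge0.
by rewrite /level_step; case: ifP => // _; rewrite c_ge0 // leq_subr.
Qed.

Let below_all j : (j <= n)%N -> below j (level_state (n - j)).
Proof.
elim: j => [|j IH] jn.
  exists 0%N; have new : level_state (n - 0).+1 = ((level_state (n - 0)).1.+1, c 0%N).
    by rewrite level_afterE // /level_step c0 addr0 state_ge0.
  split=> //; first by case.
  - by rewrite /level new.
  - by rewrite c0 addr0 state_ge0.
  - by apply: bound_of_below; [|rewrite new|left].
have [hf|hf] := lerP (c j.+1 + c j.+1) (level_state (n - j.+1)).2.
  have new : level_state (n - j.+1).+1 = ((level_state (n - j.+1)).1.+1, c j.+1).
    by rewrite level_afterE // /level_step hf.
  exists j.+1; split=> // [i||]; first by lia.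
    by rewrite /level new.
  apply: bound_of_below; rewrite ?new //; right; exists j => //; apply: IH; lia.
have same : level_state (n - j) = level_state (n - j.+1).
  by rewrite level_stateS // level_afterE // /level_step leNgt hf.
have [|e [ej lev_e e1 half bnd]] := IH; first by lia.
exists e; rewrite -same; split=> // [|i /andP[ei]]; first by lia.
rewrite leq_eqVlt => /orP[/eqP ->|ij]; last by apply: lev_e; lia.
by rewrite same /level level_afterE // /level_step leNgt hf.
Qed.

Let bound_top j : (j <= n)%N -> (level_state (n - j).+1).2 = c j -> bound j.
Proof.
move=> jn E; apply: bound_of_below => //.
case: j jn {E} => [|j] jn; [by left|right; exists j => //].
by apply: below_all; lia.
Qed.

(** Take for [t] the step that opened the level of [j]. If it is not [j] itself, the halving test
    failed at [j], so c t < 2 c j. *)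
Lemma level_cut j : (j <= n)%N -> exists t,
  [/\ (j <= t <= n)%N, forall i, (t < i <= n)%N -> (level i < level j)%N,
      forall i, (i <= t)%N -> (level j <= level i)%N, c t <= 2 * c j &
      \sum_(0 <= l < B) K (fun i => (i <= t)%N && (level i == l)) <= 3 * c t].
Proof.
move=> jn.
suff [t [jt hi lo Ecu bnd]] : exists t,
    [/\ (j <= t <= n)%N, forall i, (t < i <= n)%N -> (level i < level j)%N,
        level t = level j, (level_state (n - j).+1).2 = c t & bound t].
  exists t; split=> // [i it|]; first by rewrite -lo level_anti.
  rewrite -Ecu level_afterE // /level_step; have cj := c_ge0 jn.
  by have [_|/=] := lerP (c j + c j); [rewrite /=|]; lra.
move: {2}(n - j)%N (erefl (n - j)%N) => m; elim: m j jn => [|m IH] j jn Em.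
  have jE : j = n by lia.
  have E2 : (level_state (n - j).+1).2 = c j.
    by rewrite level_afterE // /level_step jE subnn /=; case: ifP.
  exists j; rewrite leqnn jn; split=> //; [by move=> i; lia|exact: bound_top].
have [||t [jt hi lo Ecu bnd]] := IH j.+1; [by lia|by lia|].
have jn' : (j < n)%N by lia.
have := level_afterE jn; rewrite level_stateS // /level_step.
case: ifP => _ Ej; last first.
  exists t; rewrite Ej; split=> //; [lia|move=> i it|].
    by rewrite {2}/level Ej; apply: hi.
  by rewrite lo /level Ej.
have lj : level j = (level j.+1).+1 by rewrite {1}/level Ej.
exists j; rewrite leqnn jn; split=> //; [|by rewrite Ej|by apply: bound_top; rewrite ?Ej].
by move=> i /andP[ji _]; rewrite lj ltnS level_anti.
Qed.

End Levels.

(** * The labelling of the points and its robustness *)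

Section Solution.
Variable R : realType.
Implicit Types (V W : {fset R}) (v : R) (k : nat).

Definition pts V : seq R := sort <=%R V.
Definition coord V : nat -> R := nth 0 (pts V).
Definition halfsize V := (size (pts V))./2.
Definition point_step V v :=
  step (coord V) (size (pts V)) (halfsize V) (index v (pts V)).
Definition point_level V : nat -> nat :=
  level (gcost (coord V) (size (pts V))) (halfsize V).

(** Label 0 collects the points to be matched afresh: the arrivals and all levels above that of step
    n - k. Since a level is kept or released as a whole, kept classes do not depend on [k]. *)
Definition point_label V k v : nat :=
  if v \in V then
    let l := point_level V (point_step V v) in
    if (l < point_level V (halfsize V - k))%N then 0%N else l.+1
  else 0%N.

Definition solution V k W := label_matching (V `|` W) (point_label V k).

Lemma mem_pts V : pts V =i V.
Proof. by move=> v; rewrite mem_sort. Qed.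

Lemma uniq_pts V : uniq (pts V).
Proof. by rewrite sort_uniq fset_uniq. Qed.

Lemma sorted_pts V : sorted <=%R (pts V).
Proof. by apply: sort_sorted; exact: le_total. Qed.

Lemma size_pts V : size (pts V) = #|` V|.
Proof. by rewrite size_sort. Qed.

Lemma coord_mono V p q : (p <= q)%N -> (q < size (pts V))%N ->
  coord V p <= coord V q.
Proof.
by move=> pq lt; apply: (sorted_leq_nth le_trans lexx) => //; rewrite ?inE ?sorted_pts ?(leq_ltn_trans pq).
Qed.

Lemma filter_pts V W : filter (fun v => v \in V) (pts (V `|` W)) = pts V.
Proof.
apply: (sorted_eq le_trans le_anti); rewrite ?sorted_pts //.
  by apply: sorted_filter (sorted_pts _); exact: le_trans.
apply: uniq_perm; rewrite ?filter_uniq ?uniq_pts // => v.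
by rewrite mem_filter !mem_pts inE; case: (v \in V).
Qed.

Section Fixed.
Variables (V W : {fset R}) (k : nat).
Hypotheses (evV : ~~ odd #|` V|) (cardW : #|` W| = k.*2) (disj : [disjoint V & W]).

Let N := size (pts V).
Let n := halfsize V.
Let A := pts (V `|` W).
Let c := gcost (coord V) N.
Let lv := point_level V.
Let stp := point_step V.

Let nN : n.*2 = N.
Proof. by rewrite /n /halfsize -/N even_halfK // /N size_pts. Qed.

Let stp_range v : v \in V -> (0 < stp v <= n)%N.
Proof.
move=> vV; apply: step_half; first exact: nN.
by rewrite index_mem mem_pts.
Qed.

Let on_step (P : pred nat) v := (v \in V) && P (stp v).

Let filter_on_step (P : pred nat) : filter (on_step P) A =
  map (coord V) [seq p <- iota 0 N | P (step (coord V) N n p)].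
Proof.
have -> : filter (on_step P) A = filter (fun v => P (stp v)) (pts V).
  by rewrite -(filter_pts V W) -filter_predI; apply: eq_filter => v; rewrite /= andbC.
rewrite -[pts V in LHS](mkseq_nth 0) filter_map; congr map.
apply: eq_in_filter => p; rewrite mem_iota /= add0n => pN.
by rewrite /stp /point_step index_uniq ?uniq_pts.
Qed.

Let count_on_step (P : pred nat) : count (on_step P) A = (count P (iota 1 n)).*2.
Proof.
rewrite -size_filter filter_on_step size_map size_filter.
rewrite -(@count_step R (coord V) N n P) ?nN //.
apply: eq_in_count => p; rewrite mem_iota /= add0n => pN.
by rewrite -lt0n; have /andP[-> _] := step_half (coord V) nN pN.
Qed.

Let even_on_step P : ~~ odd (count (on_step P) A).
Proof. by rewrite count_on_step odd_double. Qed.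

Let K (P : pred nat) := alt (filter (on_step P) A).

Let cE j : (j <= n)%N -> c j = K (fun i => (i <= j)%N).
Proof.
move=> jn; rewrite /c gcost_alt; [|by rewrite -nN odd_double|by rewrite -nN leq_double].
rewrite /K filter_on_step; congr alt; congr map.
apply: eq_in_filter => p; rewrite mem_iota /= add0n => pN.
rewrite (step_stable (coord V) p jn) ?nN // -lt0n.
by have /andP[-> _] := step_half (coord V) nN pN.
Qed.

Let c_ge0 j : (j <= n)%N -> 0 <= c j.
Proof. by move=> jn; apply: gcost_ge0; [exact: coord_mono|rewrite -nN leq_double]. Qed.

Let sortedA : sorted <=%R A := sorted_pts _.

(** The segment is the symmetric difference of two greedy stages. *)
Let K_seg e j : (e <= j)%N -> (j <= n)%N ->
  K (fun i => (e < i <= j)%N) <= c e + c j.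
Proof.
move=> ej jn; rewrite !cE //; last by lia.
apply: le_trans (alt_addb sortedA (even_on_step _) (even_on_step _)).
rewrite le_eqVlt; apply/orP; left; apply/eqP; congr alt; apply: eq_filter => v.
rewrite /on_step; case: (v \in V) => //=; lia.
Qed.

Let K_ext (P Q : pred nat) : (forall i, (0 < i <= n)%N -> P i = Q i) -> K P = K Q.
Proof.
move=> PQ; congr alt; apply: eq_filter => v; rewrite /on_step.
by case: (boolP (v \in V)) => //= /stp_range; exact: PQ.
Qed.

Let K_pred0 : K pred0 = 0.
Proof.
by rewrite /K (eq_filter (a2 := pred0)) ?filter_pred0 // => v; rewrite /on_step andbF.
Qed.

Let size_A : size A = (n + k).*2.
Proof.
have := cardfsUI V W; rewrite (eqP disj) cardfs0 addn0 size_pts => ->.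
by rewrite cardW doubleD nN /N size_pts.
Qed.

Let countV : count (predC (fun v => v \in V)) A = k.*2.
Proof.
have := count_predC (fun v => v \in V) A.
by rewrite -size_filter filter_pts size_A doubleD nN; lia.
Qed.

(** At most 2k of the n + k sorted pairs meet [W]; the others are disjoint pairs of neighbours in
    [pts V], which greedy matches at no greater cost. *)
Let opt_lb : c (n - k) <= alt A.
Proof.
have [j [y [sel le sz]]] := selection_alt (fun v => v \in V) sortedA.
rewrite size_A countV in sz.
rewrite filter_pts -[pts V](mkseq_nth 0) in sel.
have {}sel := selection_eq (sorted_gap (coord V) N) (selection_map sel).
have [||y' sel' le'] := selection_leq _ sel (i := (n - k)%N).
- by apply: sorted_iota_ge0; exact: coord_mono.
- by lia.
have := @gcost_opt R (coord V) N 0 (n - k) y'.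
rewrite /uncov /step /= filter_predT add0n -/c => H.
have := H _ sel'; rewrite -nN leq_double leq_subr => /(_ isT).
by rewrite [c 0%N](_ : _ = 0) // add0r => h; apply: le_trans h (le_trans le' le).
Qed.

Let lv_bound v : v \in V -> (lv (stp v) < (lv 0%N).+1)%N.
Proof. by move=> _; rewrite ltnS; apply: level_anti. Qed.

Let evenA : ~~ odd (count predT A).
Proof. by rewrite count_predT size_A odd_double. Qed.

Lemma optimal_matching :
  min_cost_perfect_matching (V `|` W) (label_matching (V `|` W) (fun=> 0%N)) /\
  cost (label_matching (V `|` W) (fun=> 0%N)) = alt A.
Proof.
have [||pm] := @label_matchingP R (V `|` W) (fun=> 0%N) 1; first by [].
  move=> j; case: (eqVneq 0%N j) => [_|ne]; first exact: evenA.
  by rewrite (eq_count (a2 := pred0)) ?count_pred0 // => v; apply/negbTE.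
rewrite big_nat1 (eq_filter (a2 := predT)) ?filter_predT -/(pts _) -/A // => costO.
by split=> //; split=> // M; rewrite costO; apply: alt_le_cost.
Qed.

(** A positive label is decided by the step, and each step covers two points; label 0 gets the rest
    of an even total. *)
Lemma point_label_even j :
  ~~ odd (count (fun v => point_label V k v == j) (pts (V `|` W))).
Proof.
case: j => [|l]; last first.
  pose P i := (lv (n - k) <= lv i)%N && (lv i == l).
  rewrite (eq_count (a2 := on_step P)) // => v; rewrite /on_step /P /point_label.
  by case: (v \in V) => //=; rewrite -/lv -/stp -/n; case: (ltnP (lv (stp v))).
have := count_predC (fun v => point_label V k v == 0%N) A.
move=> /(congr1 odd); rewrite size_A odd_double oddD.
pose P i := (lv (n - k) <= lv i)%N.
rewrite [X in _ (+) odd X](eq_count (a2 := on_step P)).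
  by rewrite (negbTE (even_on_step _)) addbF => ->.
move=> v; rewrite /on_step /P /= /point_label.
by case: (v \in V) => //=; rewrite -/lv -/stp -/n; case: (ltnP (lv (stp v))).
Qed.

(** The free points are the symmetric difference of all points and the kept ones, so they cost at
    most alt A + c t. With 3 c t for the kept levels and c t <= 2 c (n - k) <= 2 alt A, the total is
    at most 9 alt A. *)
Lemma solution_spec : exists t,
  [/\ (n - k <= t <= n)%N,
      forall v, v \in V -> (t < stp v)%N = (lv (stp v) < lv (n - k))%N,
      (count (fun v => (t < stp v)%N) (pts V) <= k.*2)%N &
      perfect_matching (V `|` W) (solution V k W) /\
      cost (solution V k W) <= 9 * alt A].
Proof.
have [||t [tn hi lo ct bnd]] :=
    @level_cut R c n K (lv 0%N).+1 _ c_ge0 K_ext K_pred0 K_seg (n - k) _.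
- by rewrite /c /gcost.
- exact: leq_subr.
have cut v : v \in V -> (t < stp v)%N = (lv (stp v) < lv (n - k))%N.
  move=> /stp_range/andP[_ vn]; case: ltnP => vt.
    by symmetry; apply: hi; rewrite vt.
  by symmetry; rewrite ltnNge lo.
have lab0 v : v \in V -> (point_label V k v == 0%N) = (t < stp v)%N.
  by move=> vV; rewrite /point_label vV -/lv -/stp -/n -cut //; case: ifP.
exists t; split=> //.
  rewrite -(filter_pts V W) count_filter.
  rewrite (eq_count (a2 := on_step (fun i => (t < i)%N))); last first.
    by move=> v; rewrite /on_step /= andbC.
  rewrite count_on_step leq_double.
  rewrite (_ : iota 1 n = iota 1 t ++ iota (1 + t) (n - t)); last first.
    by rewrite -iotaD subnKC //; lia.
  rewrite count_cat (eq_in_count (a2 := pred0)) ?count_pred0.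
    by apply: leq_trans (count_size _ _) _; rewrite size_iota; lia.
  by move=> i; rewrite mem_iota /=; lia.
have labE l : filter (fun v => point_label V k v == l.+1) A =
    filter (on_step (fun i => (i <= t)%N && (lv i == l))) A.
  apply: eq_filter => v; rewrite /on_step.
  case: (boolP (v \in V)) => vV; last by rewrite /point_label (negbTE vV).
  rewrite /point_label vV -/lv -/stp -/n -cut // [(stp v <= t)%N]leqNgt.
  by case: ifP.
have freeE : (fun v => point_label V k v == 0%N) =1
    (fun v => predT v (+) on_step (fun i => (i <= t)%N) v).
  move=> v; rewrite /on_step /=.
  case: (boolP (v \in V)) => vV; last by rewrite /point_label (negbTE vV).
  by rewrite lab0 // ltnNge.
have [v|j|pm ->] := @label_matchingP R (V `|` W) (point_label V k) (lv 0).+2.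
- rewrite /point_label; case: (boolP (v \in V)) => // vV _; case: ifP => // _.
  by rewrite ltnS lv_bound.
- exact: point_label_even.
split=> //; rewrite -/(pts _) -/A big_nat_recl //.
rewrite (eq_filter freeE).
have := alt_addb sortedA evenA (even_on_step (fun i => (i <= t)%N)).
rewrite filter_predT -/(K _) -cE; last by lia.
under eq_bigr => l _ do rewrite labE -/(K _).
by have := opt_lb; lra.
Qed.

End Fixed.

(** A kept point has the same label class, hence the same edge, in both matchings. Each lost edge is
    thus the edge of one of the at most 2k points of [V] covered after step [t]. *)
Lemma solution_reply V W k : ~~ odd #|` V| -> #|` W| = k.*2 -> [disjoint V & W] ->
  second_stage_reply 10 2 V (solution V 0 fset0) k W (solution V k W).
Proof.
move=> evV cardW disj.
have [minO costO] := optimal_matching evV cardW disj.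
have [t [tn cut free [pm cst]]] := solution_spec evV cardW disj.
split.
  split=> //; eexists; split; first exact: minO.
  rewrite costO; apply: le_trans cst _.
  by have := alt_ge0 (sorted_pts (V `|` W)); lra.
(* For [k = 0] the threshold is the level of the last step, which is the least, so no point is
   free. *)
have label0 v : v \in V -> point_label V 0 v = (point_level V (point_step V v)).+1.
  move=> vV; rewrite /point_label vV subn0 ltnNge level_anti //.
  exact: step_leq.
have classE v : v \in V -> (point_step V v <= t)%N ->
    label_class (V `|` W) (point_label V k) v =
    label_class (V `|` fset0) (point_label V 0) v.
  move=> vV; rewrite leqNgt cut // => nfree.
  rewrite /label_class fsetU0 -/(pts _) -/(pts V) -(filter_pts V W) -filter_predI.
  have -> : point_label V k v = (point_level V (point_step V v)).+1.
    by rewrite /point_label vV (negbTE nfree).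
  apply: eq_filter => u /=; rewrite (label0 v vV).
  case: (boolP (u \in V)) => uV; last by rewrite /point_label (negbTE uV) andbF.
  rewrite label0 // /point_label uV andbT; case: ifP => // lt.
  by symmetry; apply: contraTF lt => /eqP[->].
rewrite -natrM ler_nat mul2n; apply: leq_trans free.
pose edge v := [fset v; label_mate (V `|` fset0) (point_label V 0) v].
rewrite -size_filter -(size_map edge); apply: uniq_leq_size; first exact: fset_uniq.
move=> e; rewrite inE => /andP[eM2 /imfsetP[v /= vV Ee]].
rewrite fsetU0 in vV; apply/mapP; exists v => //.
rewrite mem_filter mem_pts vV andbT ltnNge; apply: contra eM2 => le.
apply/imfsetP; exists v => /=; first by rewrite inE vV.
by rewrite Ee /label_mate classE.
Qed.

Lemma solution_robust V : ~~ odd #|` V| ->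
  two_stage_robust 10 2 V (solution V 0 fset0).
Proof.
move=> evV; split; last first.
  by move=> k W cardW disj; exists (solution V k W); exact: solution_reply.
have [|//|] := @solution_reply V fset0 0 evV; first by rewrite cardfs0.
  by rewrite /fdisjoint fsetI0.
by rewrite fsetU0.
Qed.

End Solution.

(** * The algorithm *)

Definition blt (e1 e2 : iexp) : bexp := BNot (BILe e2 e1).
Definition beq (e1 e2 : iexp) : bexp := BAnd (BILe e1 e2) (BILe e2 e1).
Definition rlt (e1 e2 : rexp) : bexp := BNot (BRLe e2 e1).
Definition bor (b1 b2 : bexp) : bexp := BNot (BAnd (BNot b1) (BNot b2)).

(* Integer arrays: 3, 4 loop counters, 6 rank of a point of V1, 7 greedy step *)
(* of a rank, 8-10 the state of the scan, 11 the number of greedy steps,      *)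
(* 12 current level, 13 level of a step, 14 label, 15 and 16 index in the     *)
(* label class and its parity.  Real arrays: 1 sorted points, 2 potentials,   *)
(* 3 greedy costs, 4 the best value of the scan, 5 cost at the level's start. *)
Definition I_ := ivar 3.
Definition J_ := ivar 4.
Definition N_ := IGet 0 (ICst 0).
(** The first stage does not load this cell; it then reads 0, which is the intended [k]. *)
Definition K_ := IGet 0 (ICst 1).
Definition M_ := IAdd N_ (IAdd K_ K_).
Definition S_ (e : iexp) := RGet 0 e.
Definition n_ := ivar 11.

(** The common shape of the quadratic loops: cell [I_] of [arr] accumulates over [J_]. *)
Definition fold_prog (arr : nat) (b : bexp) (e : iexp) : prog :=
  PFor 3 (PFor 4 (PIf b (PISet arr I_ e) PSkip)).

Definition rank_prog : prog :=
  fold_prog 6 (BAnd (blt I_ N_) (BAnd (blt J_ N_) (rlt (S_ J_) (S_ I_))))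
    (IAdd (IGet 6 I_) (ICst 1)).

Definition coord_prog : prog :=
  PFor 3 (PIf (blt I_ N_) (PRSet 1 (IGet 6 I_) (S_ I_)) PSkip).

Definition pot_prog : prog :=
  let p1 := IAdd I_ (ICst 1) in
  PFor 3 (PIf (blt p1 N_)
    (PRSet 2 p1 (RSub (RSub (RGet 1 p1) (RGet 1 I_)) (RGet 2 I_))) PSkip).

Definition scan_prog : prog :=
  let l1 := ISub (ivar 8) (ICst 1) in
  let d := RAdd (RGet 2 l1) (RGet 2 J_) in
  PFor 4 (PIf (BAnd (blt J_ N_) (BILe (IGet 7 J_) (ICst 0)))
    (PSeq
      (PIf (BILe (ivar 8) (ICst 0)) PSkip
        (PIf (bor (BILe (ivar 10) (ICst 0)) (rlt d (RGet 4 (ICst 0))))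
          (PSeq (PRSet 4 (ICst 0) d)
          (PSeq (PISet 9 (ICst 0) l1) (PISet 10 (ICst 0) (IAdd J_ (ICst 1)))))
          PSkip))
      (PISet 8 (ICst 0) (IAdd J_ (ICst 1))))
    PSkip).

Definition scan_init : prog :=
  PSeq (PISet 8 (ICst 0) (ICst 0))
  (PSeq (PISet 9 (ICst 0) (ICst 0))
  (PSeq (PISet 10 (ICst 0) (ICst 0)) (PRSet 4 (ICst 0) (RCst 0)))).

Definition cover_prog : prog :=
  let i1 := IAdd I_ (ICst 1) in
  PSeq (PISet 7 (ivar 9) i1)
  (PSeq (PISet 7 (ISub (ivar 10) (ICst 1)) i1)
  (PSeq (PRSet 3 i1 (RAdd (RGet 3 I_) (RGet 4 (ICst 0))))
        (PISet 11 (ICst 0) i1))).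

Definition greedy_body : prog := PSeq scan_init (PSeq scan_prog cover_prog).

Definition greedy_prog : prog :=
  PFor 3 (PIf (blt (IAdd I_ I_) N_) greedy_body PSkip).

Definition level_loop : prog :=
  let j := ISub n_ I_ in
  PFor 3 (PIf (BILe I_ n_)
    (PSeq
      (PIf (BRLe (RAdd (RGet 3 j) (RGet 3 j)) (RGet 5 (ICst 0)))
        (PSeq (PISet 12 (ICst 0) (IAdd (ivar 12) (ICst 1)))
              (PRSet 5 (ICst 0) (RGet 3 j)))
        PSkip)
      (PISet 13 j (ivar 12)))
    PSkip).

Definition level_prog : prog :=
  PSeq (PRSet 5 (ICst 0) (RGet 3 n_)) level_loop.

(** Free points keep the initial 0 of array 14, which is their label. *)
Definition label_prog : prog :=
  let l := IGet 13 (IGet 7 (IGet 6 I_)) in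
  PFor 3 (PIf (blt I_ N_)
    (PIf (blt l (IGet 13 (ISub n_ K_))) PSkip
         (PISet 14 I_ (IAdd l (ICst 1))))
    PSkip).

Definition class_cond : bexp :=
  BAnd (blt I_ M_) (BAnd (blt J_ M_)
    (BAnd (beq (IGet 14 I_) (IGet 14 J_)) (rlt (S_ J_) (S_ I_)))).

Definition index_prog : prog :=
  fold_prog 15 class_cond (IAdd (IGet 15 I_) (ICst 1)).

(** In the absence of division, a bit is flipped once per smaller member of the class. *)
Definition parity_prog : prog :=
  fold_prog 16 class_cond (ISub (ICst 1) (IGet 16 I_)).

(** For a point of index m and parity r, the partner has the index i with i + r = m + (1 - r): m - 1
    for odd m, m + 1 for even m. *)
Definition mate_prog : prog :=
  fold_prog 2
    (BAnd (blt I_ M_) (BAnd (blt J_ M_) (BAnd (beq (IGet 14 I_) (IGet 14 J_))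
      (beq (IAdd (IGet 15 J_) (IGet 16 I_))
           (IAdd (IGet 15 I_) (ISub (ICst 1) (IGet 16 I_)))))))
    J_.

Definition main_prog : prog :=
  PSeq rank_prog (PSeq coord_prog (PSeq pot_prog (PSeq greedy_prog
  (PSeq level_prog (PSeq label_prog (PSeq index_prog
  (PSeq parity_prog mate_prog))))))).

(** One iteration more than there are points, so that the level loop reaches all of the steps n,
    ..., 0 even when there are no points. *)
Definition solve : cmd :=
  Seq (ISet bnd (ICst 0) (IAdd M_ (ICst 1))) (compile main_prog).

Lemma foldl_iotaS (T : Type) (f : T -> nat -> T) x m :
  foldl f x (iota 0 m.+1) = f (foldl f x (iota 0 m)) m.
Proof. by rewrite -addn1 iotaD foldl_cat. Qed.

(** * Double loops as folds *)

Section FoldLoops.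
Variable R : realType.
Implicit Types (st s : state R).

Lemma imem_iset st a b i j v : a != b -> imem (iset st b j v) a i = imem st a i.
Proof. by rewrite /= /upd => /negbTE ->. Qed.

(** The condition must not depend on [arr], and the new value only on the current cell of [arr];
    this keeps the cells independent of each other. *)
Lemma fold_progP st arr b e (cond : nat -> nat -> bool) (h : nat -> nat -> nat) :
  arr \notin [:: 3; 4; bnd] ->
  (forall s i j, (i < imem st bnd 0)%N -> (j < imem st bnd 0)%N ->
     imem s 3 0 = i -> imem s 4 0 = j ->
     (forall a p, a \notin [:: 3; 4; arr] -> imem s a p = imem st a p) ->
     (forall a p, rmem s a p = rmem st a p) ->
     beval s b = cond i j /\ ieval s e = h (imem s arr i) j) ->
  forall i, (i < imem st bnd 0)%N -> imem (den (fold_prog arr b e) st) arr i =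
    foldl (fun x j => if cond i j then h x j else x) (imem st arr i)
      (iota 0 (imem st bnd 0)).
Proof.
rewrite !inE !negb_or => /and3P[/negbTE a3 /negbTE a4 ab] H.
have wfi : wf (PFor 4 (PIf b (PISet arr I_ e) PSkip)).
  by rewrite /= !inE [4 == _]eq_sym a4 ab.
have wfo : wf (PFor 3 (PFor 4 (PIf b (PISet arr I_ e) PSkip))).
  by rewrite /= in wfi *; rewrite wfi !inE [3 == arr]eq_sym a3.
set B := imem st bnd 0 in H *.
set f := fun i x j => if cond i j then h x j else x.
pose P m (s : state R) := forall i, (i < B)%N ->
  imem s arr i = if (i < m)%N then foldl (f i) (imem st arr i) (iota 0 B)
                 else imem st arr i.
suff : P B (den (fold_prog arr b e) st) by move=> PB i iB; rewrite PB ?iB.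
apply: for_rule wfo _ _ => [i iB /=|i s iB si Ei Er Pi k kB].
  by rewrite /upd a3.
rewrite imem_iset ?a3 //.
have sB : imem s bnd 0 = B.
  by rewrite Ei //= !inE [bnd == arr]eq_sym (negbTE ab).
pose Q m (s' : state R) := imem s' arr k =
  if k == i then foldl (f i) (imem s arr i) (iota 0 m) else imem s arr k.
have : Q (imem s bnd 0) (den (PFor 4 (PIf b (PISet arr I_ e) PSkip)) s).
  apply: for_rule wfi _ _ => [|j s' jB s'j Ei' Er' Qj].
    by rewrite /Q /= /upd a4 /=; case: eqP => [->|].
  rewrite sB in jB; rewrite /Q foldl_iotaS [f i _ j]/f /= /upd a4 /=.
  have s'3 : imem s' 3 0 = i by rewrite Ei' //= !inE [3 == arr]eq_sym a3.
  have [||-> ->] := H s' i j iB jB s'3 s'j.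
  - move=> a p; rewrite !inE !negb_or => /and3P[n3 n4 na].
    by rewrite Ei' ?Ei //= !inE !negb_or ?n3 ?n4.
  - by move=> a p; rewrite Er' // Er.
  rewrite /Q in Qj; case: (eqVneq k i) => [ki|ki] in Qj *.
    rewrite -ki in Qj s'3 *; case: ifP => //= _.
    by rewrite /upd s'3 !eqxx /= Qj.
  by case: ifP => //= _; rewrite /upd s'3 eqxx (negbTE ki) /=.
rewrite /Q sB => ->; rewrite ltnS; case: (eqVneq k i) => [->|ki].
  by rewrite leqnn Pi // ltnn.
by rewrite Pi // [(k <= i)%N]leq_eqVlt (negbTE ki).
Qed.

Lemma fold_count (P : pred nat) m x :
  foldl (fun y j => if P j then (y + 1)%N else y) x (iota 0 m) =
  (x + count P (iota 0 m))%N.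
Proof.
elim: m => [|m IH]; first by rewrite addn0.
rewrite foldl_iotaS -[in RHS]addn1 iotaD count_cat IH /= addn0.
by case: (P _); rewrite ?addn0 ?addnA.
Qed.

Lemma fold_parity (P : pred nat) m :
  foldl (fun y j => if P j then (1 - y)%N else y) 0%N (iota 0 m) =
  odd (count P (iota 0 m)).
Proof.
elim: m => // m IH.
rewrite foldl_iotaS -[in RHS]addn1 iotaD count_cat IH /= addn0 oddD.
by case: (P _); case: odd.
Qed.

Lemma fold_unique (P : pred nat) m x j : (j < m)%N ->
  (forall i, (i < m)%N -> P i = (i == j)) ->
  foldl (fun y i => if P i then i else y) x (iota 0 m) = j.
Proof.
elim: m => // m IH jm H; rewrite foldl_iotaS H //.
case: eqP => // /eqP ne; apply: IH; first by rewrite ltn_neqAle eq_sym ne -ltnS.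
by move=> i im; apply: H; apply: ltnW.
Qed.

End FoldLoops.

Lemma count_iota_lt (P : pred nat) m B : (m <= B)%N ->
  count (fun j => (j < m)%N && P j) (iota 0 B) = count P (iota 0 m).
Proof.
move=> mB; rewrite -(subnKC mB) iotaD count_cat add0n.
rewrite (eq_in_count (a2 := P)); last first.
  by move=> j; rewrite mem_iota /= add0n => ->.
rewrite (eq_in_count (s := iota m _) (a2 := pred0)) ?count_pred0 ?addn0 //.
by move=> j; rewrite mem_iota /= => /andP[mj _]; rewrite ltnNge mj.
Qed.

Lemma count_nth_iota (T : Type) (P : pred T) x0 s :
  count (fun j => P (nth x0 s j)) (iota 0 (size s)) = count P s.
Proof. by rewrite -[s in RHS](mkseq_nth x0) count_map. Qed.

Lemma index_count_lt (R : realType) (l : seq R) v :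
  sorted <=%R l -> uniq l -> v \in l -> index v l = count (fun w => w < v) l.
Proof.
move=> srt ul vl; have := @count_lt_nth _ _ 0 l (index v l).
by rewrite nth_index // lt_sorted_uniq_le ul srt index_mem => ->.
Qed.

Lemma mate_index_eq m i : (i + odd m == m + (1 - odd m))%N =
  (i == if odd m then m.-1 else m.+1).
Proof. by case: ifP; case: m => [|m] //= _; apply/eqP/eqP; lia. Qed.

(** * Correctness of the phases of the program *)

Section Phases.
Variables (R : realType) (V W : {fset R}) (s t : seq R) (k : nat).
Hypotheses (evV : ~~ odd #|` V|) (cardW : #|` W| = k.*2).
Hypotheses (disj : [disjoint V & W]) (ps : perm_eq s V) (pt : perm_eq t W).

Let S := s ++ t.
Let N := size s.
Let M := (N + (k + k))%N.
Let n := halfsize V.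
Let x := coord V.
Let L := point_label V k.

Let size_ptsV : size (pts V) = N.
Proof. by rewrite size_pts /N (perm_size ps). Qed.

Let sizeS : size S = M.
Proof. by rewrite size_cat (perm_size pt) -[size W]/(#|` W|) cardW /M addnn. Qed.

Let nN : n.*2 = N.
Proof. by rewrite /n /halfsize even_halfK size_ptsV // /N (perm_size ps). Qed.

Let uniqS : uniq S.
Proof.
rewrite cat_uniq (perm_uniq ps) (perm_uniq pt) !fset_uniq andbT /=.
apply/hasPn => v; rewrite (perm_mem pt) /= (perm_mem ps) => vW.
by apply/negP => vV; move/fdisjointP: disj => /(_ v vV); rewrite vW.
Qed.

Let memS : S =i V `|` W.
Proof. by move=> v; rewrite mem_cat inE (perm_mem ps) (perm_mem pt). Qed.

Let permS : perm_eq S (pts (V `|` W)).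
Proof.
by apply: uniq_perm; rewrite ?uniq_pts // => v; rewrite memS mem_pts.
Qed.

Let permV : perm_eq s (pts V).
Proof.
apply: uniq_perm; rewrite ?uniq_pts ?(perm_uniq ps) ?fset_uniq // => v.
by rewrite mem_pts (perm_mem ps).
Qed.

Let nthS a : (a < N)%N -> S`_a = s`_a.
Proof. by move=> aN; rewrite nth_cat -/N aN. Qed.

Let nthV a : (a < M)%N -> (S`_a \in V) = (a < N)%N.
Proof.
move=> aM; case: ltnP => aN; first by rewrite nthS // -(perm_mem ps) mem_nth.
apply/negbTE; have : S`_a \in W.
  rewrite nth_cat -/N ltnNge aN /= -(perm_mem pt) mem_nth //.
  by rewrite -(ltn_add2l N) subnKC // -size_cat sizeS.
by apply: contraL => aV; move/fdisjointP: disj => /(_ _ aV).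
Qed.

Definition input_ok (st : state R) :=
  [/\ imem st bnd 0 = M.+1, imem st 0 0 = N, imem st 0 1 = k &
      forall i, (i < M)%N -> rmem st 0 i = S`_i].

Lemma input_ok_den c st : 0%N \notin iwrites c -> bnd \notin iwrites c ->
  0%N \notin rwrites c -> input_ok st -> input_ok (den c st).
Proof.
move=> i0 ib r0 [h1 h2 h3 h4].
by split=> [|||i iM]; rewrite ?den_iframe ?den_rframe // h4.
Qed.

Definition rank_ok (st : state R) :=
  forall a, (a < N)%N -> imem st 6 a = index S`_a (pts V).

Lemma rank_progP st : input_ok st -> (forall i, imem st 6 i = 0%N) ->
  rank_ok (den rank_prog st).
Proof.
move=> [hB hN _ hS] h0 a aN.
pose cond i j := [&& (i < N)%N, (j < N)%N & S`_j < S`_i].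
have NM : (N <= M)%N by rewrite /M leq_addr.
rewrite (fold_progP (cond := cond) (h := fun y _ => (y + 1)%N)) //; last first.
- by rewrite hB ltnS; lia.
- move=> s' i j _ _ si sj Ei Er; rewrite /= si sj !(Ei 0%N) // hN !Er; split=> //.
  rewrite /cond -!ltnNge -ltNge; case: ltnP => //= iN; case: ltnP => //= jN.
  by rewrite !hS //; lia.
rewrite fold_count h0 hB add0n /cond aN.
transitivity (count (fun j => S`_j < S`_a) (iota 0 N)).
  by apply: count_iota_lt; lia.
rewrite (eq_in_count (a2 := fun j => s`_j < s`_a)); last first.
  by move=> j; rewrite mem_iota /= add0n => jN; rewrite !nthS.
rewrite /N (count_nth_iota (fun w => w < s`_a)) nthS // (permP permV).
by rewrite -index_count_lt ?sorted_pts ?uniq_pts // -(perm_mem permV) mem_nth.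
Qed.

Definition coord_ok (st : state R) := forall p, (p < N)%N -> rmem st 1 p = x p.

Lemma coord_progP st : input_ok st -> rank_ok st -> coord_ok (den coord_prog st).
Proof.
move=> [hB hN _ hS] hr.
have NM : (N <= M)%N by rewrite /M leq_addr.
have : forall a, (a < imem st bnd 0)%N -> (a < N)%N ->
    rmem (den coord_prog st) 1 (index S`_a (pts V)) = S`_a.
  apply: (for_rule (P := fun i s' => forall a, (a < i)%N -> (a < N)%N ->
    rmem s' 1 (index S`_a (pts V)) = S`_a)) => // i s' iB si Ei Er IH a.
  rewrite ltnS => ai aN /=; rewrite si Ei // hN -ltnNge.
  case: ltnP => iN /=; last by apply: IH; lia.
  rewrite /upd /= Ei // hr // Er // hS; last by lia.
  case: (eqVneq a i) => [->|ne]; first by rewrite eqxx.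
  rewrite IH //; last by lia.
  (* Distinct points have distinct ranks, so no entry is overwritten. *)
  case: eqP => // E; move/eqP: ne; case.
  apply/eqP; rewrite -(nth_uniq 0 _ _ uniqS) ?sizeS //; try lia.
  have mem b : (b < N)%N -> S`_b \in pts V.
    by move=> bN; rewrite mem_pts nthV //; lia.
  by rewrite -(nth_index 0 (mem a aN)) E nth_index ?mem.
move=> H p pN; have xs : x p \in s.
  by rewrite (perm_mem permV) mem_nth ?size_ptsV.
have iN : (index (x p) s < N)%N by rewrite index_mem.
have := H (index (x p) s); rewrite nthS // nth_index // index_uniq ?uniq_pts ?size_ptsV //.
by apply=> //; rewrite hB; lia.
Qed.

Definition pot_ok (st : state R) := forall p, (p < N)%N -> rmem st 2 p = pot x p.

Lemma pot_progP st : input_ok st -> coord_ok st -> rmem st 2 0 = 0 ->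
  pot_ok (den pot_prog st).
Proof.
move=> [hB hN _ _] hx h0 p pN.
have : forall a, (a <= imem st bnd 0)%N -> (a < N)%N ->
    rmem (den pot_prog st) 2 a = pot x a.
  apply: (for_rule (P := fun i s' => forall a, (a <= i)%N -> (a < N)%N ->
    rmem s' 2 a = pot x a)) => // [a|i s' iB si Ei Er IH a].
    by rewrite leqn0 => /eqP ->.
  rewrite leq_eqVlt => /orP[/eqP ->|ai] aN /=; rewrite si Ei // hN -ltnNge addn1.
    rewrite aN /= /upd /= eqxx !(Er 1%N) // !hx // ?IH //; lia.
  case: ltnP => iN /=; last by apply: IH.
  by rewrite /upd /=; case: eqP => [E|_]; [move: ai; rewrite E; lia|apply: IH].
by apply=> //; rewrite hB /M; lia.
Qed.

Definition greedy_ok (st : state R) j :=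
  [/\ forall p, imem st 7 p = step x N j p,
      forall i, (i <= j)%N -> rmem st 3 i = gcost x N i & imem st 11 0 = j].

Definition scan_cells (st : state R) :=
  (imem st 8 0, imem st 9 0, imem st 10 0, rmem st 4 0).

Lemma scan_progP st (f : nat -> nat) : input_ok st -> pot_ok st ->
  (forall p, imem st 7 p = f p) -> scan_cells st = (0%N, 0%N, 0%N, 0) ->
  scan_cells (den scan_prog st) = scan x [seq p <- iota 0 N | f p == 0%N].
Proof.
move=> [hB hN _ _] hz hf h0.
pose C p := (p < N)%N && (f p == 0%N).
pose sc i := foldl (scan_step x) (0%N, 0%N, 0%N, 0) (filter C (iota 0 i)).
have scS i : sc i.+1 = if C i then scan_step x (sc i) i else sc i.
  rewrite /sc -addn1 iotaD filter_cat foldl_cat /= add0n.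
  by case: (C i).
(* The second conjunct keeps the last position read within the range where the potentials are
   known. *)
suff [E _] : scan_cells (den scan_prog st) = sc (imem st bnd 0) /\
    (imem (den scan_prog st) 8 0 <= N)%N.
  rewrite E /sc /scan hB; congr foldl.
  have -> : M.+1 = (N + (M.+1 - N))%N by rewrite /M; lia.
  rewrite iotaD filter_cat add0n [X in _ ++ X](_ : _ = [::]).
    by rewrite cats0; apply: eq_in_filter => p; rewrite mem_iota /C => /andP[_ ->].
  apply/eqP; rewrite -(negbK (_ == _)) -has_filter; apply/hasPn => p.
  by rewrite mem_iota /C => /andP[Np _]; rewrite ltnNge Np.
apply: (for_rule (P := fun i s' => scan_cells s' = sc i /\ (imem s' 8 0 <= N)%N)) => //.
  by have [E8 _ _ _] := h0; split; [exact: h0|rewrite /= /upd /= E8].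
move=> i s' iB si Ei Er [IH l8]; rewrite scS.
have [hC|hC] := boolP (C i); last first.
  rewrite /= si Ei // hN -ltnNge Ei // hf leqn0.
  by move: hC; rewrite /C => /negbTE ->.
have [iN fi0] := andP hC.
move: IH; rewrite /scan_cells; case: (sc i) => [[[l bp] bq] bv] [El Ep Eq Ev].
rewrite /= si Ei // hN -ltnNge Ei // hf leqn0 iN fi0 /= El leqn0.
case: eqP => [l0|/eqP l0] /=.
  by rewrite /scan_cells /= /upd /= si Ep Eq Ev addn1; split=> //.
have zl : rmem s' 2 (l - 1) = pot x l.-1.
  by rewrite Er // hz subn1 //; move: l8; rewrite El; lia.
have zi : rmem s' 2 i = pot x i by rewrite Er // hz.
rewrite zl zi Eq Ev leqn0 negb_and !negbK -ltNge.
case: ifP => _ /=.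
  by rewrite /upd /= si addn1 subn1.
by rewrite /upd /= si Ep Eq Ev addn1.
Qed.

Lemma greedy_scan j l bp bq bv : scan x (uncov x N j) = (l, bp, bq, bv) ->
  (forall p, step x N j.+1 p =
     if (p == bp) || (p == bq.-1) then j.+1 else step x N j p) /\
  gcost x N j.+1 = gcost x N j + bv.
Proof.
by rewrite /uncov /step /gcost /=; case: (greedy x N j) => f c /= ->.
Qed.

Lemma greedy_progP st : input_ok st -> pot_ok st ->
  (forall p, imem st 7 p = 0%N) -> rmem st 3 0 = 0 -> imem st 11 0 = 0%N ->
  greedy_ok (den greedy_prog st) n.
Proof.
move=> inp hz f0 c0 n0; have [hB hN _ _] := inp.
(* The loop goes on idly after the n greedy steps, hence the minimum. *)
have : greedy_ok (den greedy_prog st) (minn (imem st bnd 0) n).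
  apply: (for_rule (P := fun i s' => greedy_ok s' (minn i n))) => //.
    by rewrite min0n; split=> //= i; rewrite leqn0 => /eqP ->.
  move=> i s' iB si Ei Er [hf hc hn].
  rewrite [den _ s'](_ : _ = if beval s' (blt (IAdd I_ I_) N_)
    then den greedy_body s' else s') // [beval _ _]/= si Ei // hN -ltnNge addnn.
  rewrite -nN ltn_double; case: ltnP => iN; last first.
    have -> : minn i.+1 n = minn i n by lia.
    by split.
  have -> : minn i.+1 n = i.+1 by lia.
  have mi : minn i n = i by lia.
  rewrite mi in hf hc hn.
  have inp' : input_ok s'.
    have [_ ? h2 h3] := inp.
    by split=> [|||j jM]; rewrite ?Ei ?Er // h3.
  have hz' : pot_ok s' by move=> p pN; rewrite Er // hz.
  rewrite [den _ _](_ : _ = den cover_prog (den scan_prog (den scan_init s'))) //.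
  have := @scan_progP (den scan_init s') (step x N i).
  set s2 := den scan_prog _ => /(_ _ _ _ erefl) Hs2.
  have {Hs2} : scan_cells s2 = scan x (uncov x N i).
    apply: Hs2 => [|p pN|p]; [exact: input_ok_den|exact: hz'|exact: hf].
  have s2f p : imem s2 7 p = step x N i p by rewrite !den_iframe // hf.
  have s2c j : (j <= i)%N -> rmem s2 3 j = gcost x N j.
    by move=> ji; rewrite !den_rframe // hc.
  have s2i : imem s2 3 0 = i by rewrite !den_iframe // si.
  move: s2 s2f s2c s2i => s2 s2f s2c s2i.
  case Es: (scan x (uncov x N i)) => [[[l bp] bq] bv] [_ Ep Eq Ev].
  have [stepS costS] := greedy_scan Es.
  split=> [p|j|] /=.
  - by rewrite stepS /upd /= Ep Eq s2i subn1 addn1 s2f; do 2!case: eqP.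
  - rewrite /upd /= s2i addn1 leq_eqVlt => /orP[/eqP ->|ji].
      by rewrite eqxx costS Ev s2c.
    by case: eqP => [E|_]; [move: ji; rewrite E ltnn|rewrite s2c].
  - by rewrite /upd /= s2i addn1.
by have -> : minn (imem st bnd 0) n = n by rewrite hB /M -nN; lia.
Qed.

Definition level_ok (st : state R) := forall j, (j <= n)%N ->
  imem st 13 j = point_level V j.

Lemma level_progP st : input_ok st -> greedy_ok st n -> imem st 12 0 = 0%N ->
  level_ok (den level_prog st).
Proof.
move=> [hB hN _ _] [_ hc hn] l0.
pose st1 := rset st 5 0 (rmem st 3 (imem st 11 0)).
rewrite [den _ _](_ : _ = den level_loop st1) //.
pose c := gcost x N.
have hB1 : imem st1 bnd 0 = M.+1 by [].
have : [/\ imem (den level_loop st1) 12 0 = (level_state c n (minn (imem st1 bnd 0) n.+1)).1,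
    rmem (den level_loop st1) 5 0 = (level_state c n (minn (imem st1 bnd 0) n.+1)).2 &
    forall j, (j <= n)%N -> (n - j < imem st1 bnd 0)%N ->
      imem (den level_loop st1) 13 j = level c n j].
  apply: (for_rule (P := fun i s' =>
    [/\ imem s' 12 0 = (level_state c n (minn i n.+1)).1,
        rmem s' 5 0 = (level_state c n (minn i n.+1)).2 &
        forall j, (j <= n)%N -> (n - j < i)%N -> imem s' 13 j = level c n j])) => //.
    by split=> //; rewrite /= /upd /= hn hc.
  move=> i s' iB si Ei Er [h12 h5 h13].
  have hn' : imem s' 11 0 = n by rewrite Ei.
  have hc' j : (j <= n)%N -> rmem s' 3 j = c j by move=> jn; rewrite Er // /st1 /= /upd /= hc.
  rewrite /= si hn'; case: leqP => i_n; last first.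
    have -> : minn i.+1 n.+1 = minn i n.+1 by lia.
    by split=> // j jn ji; apply: h13 => //; lia.
  rewrite hc' ?leq_subr //= h5.
  have mi : minn i n.+1 = i by lia.
  have -> : minn i.+1 n.+1 = i.+1 by lia.
  rewrite mi in h12 h5 *; rewrite /= /level_step.
  have lj j : (j <= n)%N -> (n - j < i.+1)%N -> j <> (n - i)%N -> (n - j < i)%N by lia.
  have levE : level c n (n - i) = (level_state c n i.+1).1 by rewrite /level subKn.
  case: ifP => hh; split=> /=.
  - by rewrite /upd /= h12 addn1.
  - by rewrite /upd /= hn' si hc' ?leq_subr.
  - move=> j jn ji; rewrite /upd /= hn' si; case: eqP => [->|ne].
      by rewrite levE /= /level_step hh h12 addn1.
    by rewrite h13 // lj.
  - by rewrite /upd /= h12.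
  - by rewrite h5.
  - move=> j jn ji; rewrite /upd /= hn' si; case: eqP => [->|ne].
      by rewrite levE /= /level_step hh h12.
    by rewrite h13 // lj.
move=> [_ _ H] j jn; rewrite H // ?hB1; last by rewrite /M -nN; lia.
by rewrite /point_level size_ptsV.
Qed.

Definition label_ok (st : state R) :=
  forall a, (a < M)%N -> imem st 14 a = L S`_a.

Lemma label_progP st : input_ok st -> rank_ok st -> greedy_ok st n ->
  level_ok st -> (forall i, imem st 14 i = 0%N) -> label_ok (den label_prog st).
Proof.
move=> [hB hN hk _] hr [hf _ hn] hl h0 a aM.
have : forall i, imem (den label_prog st) 14 i =
    if [&& (i < imem st bnd 0)%N & (i < N)%N] then L S`_i else 0%N.
  apply: (for_rule (P := fun m s' => forall i, imem s' 14 i =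
    if [&& (i < m)%N & (i < N)%N] then L S`_i else 0%N)) => // i s' iB si Ei Er IH j.
  rewrite imem_iset // [den _ _]/= si (Ei 0%N) // hN -ltnNge.
  case: ltnP => iN; last first.
    by rewrite IH; congr (if _ then _ else _); lia.
  have step_i : step x N n (index S`_i (pts V)) = point_step V S`_i.
    by rewrite /point_step size_ptsV.
  have iV : S`_i \in V by rewrite nthV // /M; lia.
  have /andP[_ sn] : (0 < point_step V S`_i <= n)%N.
    by rewrite -step_i step_half // -size_ptsV index_mem mem_pts.
  rewrite !(Ei 6%N) // hr // !(Ei 7%N) // hf step_i !(Ei 13%N) // !(Ei 11%N) //.
  rewrite hn (Ei 0%N) // hk !hl ?leq_subr // -ltnNge.
  case: ifP => lt.
    rewrite IH; case: (eqVneq j i) => [->|ne].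
      by rewrite ltnn ltnS leqnn iN /L /point_label iV lt.
    by congr (if _ then _ else _); lia.
  rewrite /= /upd /= addn1; case: (eqVneq j i) => [->|ne].
    by rewrite leqnn iN /L /point_label iV lt.
  by rewrite IH; congr (if _ then _ else _); lia.
move=> /(_ a) ->; rewrite hB; case: ltnP => //= [_|]; last by lia.
by case: ltnP => // Na; rewrite /L /point_label nthV // ltnNge Na.
Qed.

Let cls v := label_class (V `|` W) L v.

Definition class_test i j :=
  [&& (i < M)%N, (j < M)%N, L S`_i == L S`_j & S`_j < S`_i].

Let class_condP st arr s' i j : input_ok st -> label_ok st ->
  arr \notin [:: 0; 3; 4; bnd; 14]%N -> imem s' 3 0 = i -> imem s' 4 0 = j ->
  (forall a p, a \notin [:: 3; 4; arr]%N -> imem s' a p = imem st a p) ->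
  (forall a p, rmem s' a p = rmem st a p) ->
  beval s' class_cond = class_test i j.
Proof.
move=> [hB hN hk hS] hL; rewrite !inE !negb_or => /and5P[a0 _ _ _ a14] si sj Ei Er.
rewrite /= si sj !(Ei 0%N) ?hN ?hk; try by rewrite !inE [0%N == arr]eq_sym (negbTE a0).
rewrite !(Ei 14%N); try by rewrite !inE [14 == arr]eq_sym (negbTE a14).
rewrite !Er /class_test -!ltnNge -ltNge -/M.
case: ltnP => //= iM; case: ltnP => //= jM.
by rewrite !hS // !hL // -eqn_leq.
Qed.

Let class_count a : (a < M)%N ->
  count (class_test a) (iota 0 M.+1) = index S`_a (cls S`_a).
Proof.
move=> aM; pose P w := (w < S`_a) && (L w == L S`_a).
transitivity (count (fun j => P S`_j) (iota 0 M)).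
  rewrite -(count_iota_lt _ (leqnSn M)); apply: eq_count => j.
  by rewrite /class_test aM /P [L S`_j == _]eq_sym [(_ < _) && _]andbC.
rewrite -sizeS (count_nth_iota P) (permP permS).
have Sa : S`_a \in cls S`_a.
  by rewrite mem_filter eqxx mem_pts -memS mem_nth ?sizeS.
rewrite index_count_lt ?filter_uniq ?uniq_pts //.
  by rewrite count_filter.
by apply: sorted_filter (sorted_pts _); exact: le_trans.
Qed.

Definition index_ok (st : state R) :=
  forall a, (a < M)%N -> imem st 15 a = index S`_a (cls S`_a).

Lemma index_progP st : input_ok st -> label_ok st ->
  (forall i, imem st 15 i = 0%N) -> index_ok (den index_prog st).
Proof.
move=> inp hL h0 a aM; have [hB _ _ _] := inp.
rewrite (fold_progP (cond := class_test) (h := fun y _ => (y + 1)%N)) //; last first.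
- by rewrite hB ltnW.
- move=> s' i j _ _ si sj Ei Er; split; last by rewrite /= si.
  exact: class_condP Ei Er.
by rewrite fold_count h0 hB add0n class_count.
Qed.

Definition parity_ok (st : state R) :=
  forall a, (a < M)%N -> imem st 16 a = odd (index S`_a (cls S`_a)).

Lemma parity_progP st : input_ok st -> label_ok st ->
  (forall i, imem st 16 i = 0%N) -> parity_ok (den parity_prog st).
Proof.
move=> inp hL h0 a aM; have [hB _ _ _] := inp.
rewrite (fold_progP (cond := class_test) (h := fun y _ => (1 - y)%N)) //; last first.
- by rewrite hB ltnW.
- move=> s' i j _ _ si sj Ei Er; split; last by rewrite /= si.
  exact: class_condP Ei Er.
by rewrite h0 fold_parity hB class_count.
Qed.

Lemma mate_progP st : input_ok st -> label_ok st -> index_ok st ->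
  parity_ok st -> forall a, (a < M)%N ->
  (imem (den mate_prog st) 2 a < M)%N /\
  S`_(imem (den mate_prog st) 2 a) = label_mate (V `|` W) L S`_a.
Proof.
move=> [hB hN hk _] hL hI hP a aM; set v := S`_a.
have uC : uniq (cls v) by rewrite filter_uniq ?uniq_pts.
have inC w : (w \in cls v) = (L w == L v) && (w \in S).
  by rewrite mem_filter mem_pts memS.
have vC : v \in cls v by rewrite inC eqxx mem_nth ?sizeS.
have evC : ~~ odd (size (cls v)).
  rewrite size_filter; apply: point_label_even => //.
set w := label_mate _ _ _.
have wC : w \in cls v by apply: mate_in.
have [Lw wS] := andP (etrans (esym (inC w)) wC).
have iw : (index w S < M)%N by rewrite -sizeS index_mem.
suff -> : imem (den mate_prog st) 2 a = index w S by rewrite nth_index.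
pose idx i := index S`_i (cls S`_i).
pose cond i j := [&& (i < M)%N, (j < M)%N, L S`_i == L S`_j &
  (idx j + odd (idx i) == idx i + (1 - odd (idx i)))%N].
rewrite (fold_progP (cond := cond) (h := fun _ j => j)) //; last first.
- by rewrite hB ltnW.
- move=> s' i j _ _ si sj Ei _; split=> //.
  rewrite /= si sj !(Ei 0%N) // !(Ei 14%N) // !(Ei 15%N) // !(Ei 16%N) // hN hk.
  rewrite -!ltnNge -/M /cond; case: ltnP => //= iM; case: ltnP => //= jM.
  by rewrite !hL // !hI // !hP // -!eqn_leq.
apply: fold_unique => [|j]; first by rewrite hB ltnW.
rewrite hB ltnS leq_eqVlt => /orP[/eqP ->|jM].
  by rewrite /cond ltnn andbF gtn_eqF.
rewrite /cond /idx aM jM -/v /=.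
have -> : (j == index w S) = (S`_j == w).
  by rewrite -[w in RHS](nth_index 0 wS) nth_uniq ?sizeS.
have [Lj|Lj] := eqVneq (L v) (L S`_j) => /=; last first.
  apply/esym/negbTE; apply: contraNneq Lj => ->.
  by rewrite eq_sym.
have -> : cls S`_j = cls v by rewrite /cls /label_class Lj.
have jC : S`_j \in cls v by rewrite inC -Lj eqxx mem_nth ?sizeS.
have -> : (S`_j == w) = (index S`_j (cls v) == index w (cls v)).
  by apply/eqP/eqP => [->//|E]; rewrite -(nth_index 0 jC) E nth_index.
by rewrite index_mate // mate_index_eq.
Qed.

Lemma main_progP st : input_ok st ->
  (forall a i, a \in [:: 6; 7; 11; 12; 14; 15; 16]%N -> imem st a i = 0%N) ->
  rmem st 2 0 = 0 -> rmem st 3 0 = 0 ->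
  forall a, (a < M)%N ->
    (imem (den main_prog st) 2 a < M)%N /\
    S`_(imem (den main_prog st) 2 a) = label_mate (V `|` W) L S`_a.
Proof.
move=> in0 z r2 r3.
pose st1 := den rank_prog st; pose st2 := den coord_prog st1.
pose st3 := den pot_prog st2; pose st4 := den greedy_prog st3.
pose st5 := den level_prog st4; pose st6 := den label_prog st5.
pose st7 := den index_prog st6; pose st8 := den parity_prog st7.
rewrite [den main_prog st](_ : _ = den mate_prog st8) //.
have in1 : input_ok st1 by exact: input_ok_den.
have in2 : input_ok st2 by exact: input_ok_den.
have in3 : input_ok st3 by exact: input_ok_den.
have in4 : input_ok st4 by exact: input_ok_den.
have in5 : input_ok st5 by exact: input_ok_den.
have in6 : input_ok st6 by exact: input_ok_den.
have in7 : input_ok st7 by exact: input_ok_den.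
have in8 : input_ok st8 by exact: input_ok_den.
have rk1 : rank_ok st1 by apply: rank_progP => // i; rewrite z.
have x2 : coord_ok st2 by exact: coord_progP.
have z3 : pot_ok st3.
  by apply: pot_progP => //; rewrite /st2 /st1 !den_rframe.
have g4 : greedy_ok st4 n.
  by apply: greedy_progP => // [p||];
    rewrite /st3 /st2 /st1 ?den_rframe ?den_iframe ?z.
have l5 : level_ok st5.
  by apply: level_progP => //; rewrite /st4 /st3 /st2 /st1 !den_iframe ?z.
have rk5 : rank_ok st5.
  move=> a aN; rewrite (den_iframe (c := level_prog)) //.
  rewrite (den_iframe (c := greedy_prog)) // (den_iframe (c := pot_prog)) //.
  by rewrite (den_iframe (c := coord_prog)) // rk1.
have g5 : greedy_ok st5 n.
  have [h1 h2 h3] := g4.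
  split=> [p|i iN|].
  - by rewrite (den_iframe (c := level_prog)) // h1.
  - by rewrite (den_rframe (c := level_prog)) // h2.
  - by rewrite (den_iframe (c := level_prog)) // h3.
have L6 : label_ok st6.
  by apply: label_progP => // i; rewrite /st5 /st4 /st3 /st2 /st1 !den_iframe ?z.
have i7 : index_ok st7.
  by apply: index_progP => // i; rewrite /st6 /st5 /st4 /st3 /st2 /st1 !den_iframe ?z.
have L7 : label_ok st7 by move=> a aM; rewrite (den_iframe (c := index_prog)) // L6.
have p8 : parity_ok st8.
  by apply: parity_progP => // i;
    rewrite /st7 /st6 /st5 /st4 /st3 /st2 /st1 !den_iframe ?z.
apply: mate_progP => //.
- by move=> a aM; rewrite (den_iframe (c := parity_prog)) // L7.
- by move=> a aM; rewrite (den_iframe (c := parity_prog)) // i7.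
Qed.

Lemma encodes_solution (g : nat -> nat) :
  (forall a, (a < M)%N ->
     (g a < M)%N /\ S`_(g a) = label_mate (V `|` W) L S`_a) ->
  encodes S (mkseq g M) (solution V k W).
Proof.
move=> spec; split; first by rewrite size_mkseq sizeS.
  apply/allP => j /mapP[a]; rewrite mem_iota sizeS add0n => /= aM ->.
  by have [] := spec a aM.
have edgeE a : (a < M)%N -> [fset S`_a; S`_(nth 0%N (mkseq g M) a)] =
    [fset S`_a; label_mate (V `|` W) L S`_a].
  by move=> aM; rewrite nth_mkseq //; have [_ ->] := spec a aM.
apply/fsetP => e; apply/imfsetP/imfsetP => [] [].
  move=> v /= vV ->; have vS : v \in S by rewrite memS.
  have iv : (index v S < M)%N by rewrite -sizeS index_mem.
  by exists (index v S); rewrite /= ?mem_iota ?add0n ?sizeS // edgeE // nth_index.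
move=> a; rewrite /= mem_iota add0n sizeS => /= aM ->.
by exists S`_a; rewrite ?edgeE //= -memS mem_nth ?sizeS.
Qed.

(** The 12 is the price of setting the loop bound, and 2 ^ d comes from M + 2 <= 2 (N + k + 1). *)
Lemma solve_computes st C d :
  (forall B, (time main_prog B <= C * B.+1 ^ d)%N) ->
  imem st 0 0 = N -> imem st 0 1 = k ->
  (forall a i, (1 < a)%N -> imem st a i = 0%N) ->
  (forall i, rmem st 0 i = S`_i) ->
  (forall a i, (0 < a)%N -> rmem st a i = 0) ->
  exists m, computes_within ((C + 12) * 2 ^ d * (N + k).+1 ^ d) solve st m /\
            encodes S m (solution V k W).
Proof.
move=> timeC hN hk z hS r.
pose st1 := iset st bnd 0 M.+1.
have in1 : input_ok st1 by split=> [|||i _]; rewrite /= /upd /=.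
have spec : forall a, (a < M)%N -> (imem (den main_prog st1) 2 a < M)%N /\
    S`_(imem (den main_prog st1) 2 a) = label_mate (V `|` W) L S`_a.
  apply: main_progP => //; try exact: r.
  move=> a i; rewrite !inE => ain; rewrite imem_iset; last first.
    by apply/eqP => E; rewrite E in ain.
  by apply: z; move: ain; case: a => [|[|a]].
exists (mkseq (imem (den main_prog st1) 2) M); split.
  have [nn ex le] := compile_exec st1 (isT : wf main_prog).
  exists (12 + nn)%N, (den main_prog st1); split.
  - apply: exec_seq ex; rewrite /st1.
    rewrite (_ : M.+1 = ieval st (IAdd M_ (ICst 1))); first exact: exec_iset.
    by rewrite /= hN hk addn1.
  - have Mk : (M.+2 <= 2 * (N + k).+1)%N by rewrite /M; lia.
    have pd : (M.+2 ^ d <= 2 ^ d * (N + k).+1 ^ d)%N.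
      rewrite -expnMn; case: (posnP d) => [->//|d0]; by rewrite leq_exp2r.
    have p0 : (0 < 2 ^ d * (N + k).+1 ^ d)%N by rewrite muln_gt0 !expn_gt0.
    have := leq_trans le (timeC _); rewrite [imem _ _ _]/= -mulnA.
    by move: pd p0; set X := (M.+2 ^ d)%N; set Y := (2 ^ d * _)%N; nia.
  - by rewrite size_mkseq.
exact: encodes_solution spec.
Qed.

End Phases.

Theorem theorem2 (R : realType) :
  (forall V1 : {fset R}, ~~ odd #|` V1| ->
     exists M1 : {fset {fset R}}, two_stage_robust 10 2 V1 M1) /\
  (exists (stage1 stage2 : cmd) (C d : nat),
     forall (V1 : {fset R}) (s : seq R), ~~ odd #|` V1| -> perm_eq s V1 ->
     exists (m1 : seq nat) (M1 : {fset {fset R}}),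
       [/\ computes_within (C * (#|` V1|).+1 ^ d) stage1 (stage1_input s) m1,
           encodes s m1 M1,
           two_stage_robust 10 2 V1 M1 &
           forall (k : nat) (W : {fset R}) (t : seq R),
             #|` W| = k.*2 -> [disjoint V1 & W] -> perm_eq t W ->
             exists (m2 : seq nat) (M2 : {fset {fset R}}),
               [/\ computes_within (C * (#|` V1| + k).+1 ^ d) stage2
                     (stage2_input s m1 k t) m2,
                   encodes (s ++ t) m2 M2 &
                   second_stage_reply 10 2 V1 M1 k W M2]]).
Proof.
have [C [d timeC]] := time_poly main_prog.
pose C' := ((C + 12) * 2 ^ d)%N.
(* The two alternatives for the first integer array are the inputs of the second and of the first
   stage. *)
have solved (V W : {fset R}) s t k ints : ~~ odd #|` V| -> #|` W| = k.*2 ->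
    [disjoint V & W] -> perm_eq s V -> perm_eq t W ->
    nth [::] ints 0 = [:: size s; k] \/ nth [::] ints 0 = [:: size s] /\ k = 0%N ->
    (size ints <= 2)%N ->
    exists m, computes_within (C' * (#|` V| + k).+1 ^ d) solve
                (init ints [:: s ++ t]) m /\
              encodes (s ++ t) m (solution V k W).
  move=> evV cardW disj ps pt in0 sz; rewrite -(perm_size ps).
  apply: solve_computes => //=.
  - by case: in0 => [->|[-> _]].
  - by case: in0 => [->|[-> ->]].
  - by move=> a i a1; rewrite (nth_default [::]) ?nth_nil //; lia.
  - by case=> // a i _; rewrite /= !nth_nil.
split=> [V evV|]; first by exists (solution V 0 fset0); exact: solution_robust.
exists solve, solve, C', d => V s evV ps.
have [||//||||m1 [comp1 enc1]] := solved V fset0 s [::] 0%N [:: [:: size s]] evV.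
- by rewrite cardfs0.
- exact: fdisjointX0.
- by [].
- by right.
- by [].
rewrite addn0 cats0 in comp1 enc1.
exists m1, (solution V 0 fset0); split=> //; first exact: solution_robust.
move=> k W t cardW disj pt.
have [||m2 [comp2 enc2]] :=
  solved V W s t k [:: [:: size s; k]; m1] evV cardW disj ps pt; [by left|by []|].
by exists m2, (solution V k W); split=> //; exact: solution_reply.
Qed.
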